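(* Let $L$ be a parameter system on $\widetilde W$ and $\mathcal H$ the associated affine Hecke algebra with unequal parameters. Let $1\le i\le r$ with corresponding simple root $\alpha_i$, and let $\lambda\in X_*$. Then in $\mathcal H$: if $\alpha_i\notin 2X^*$, $$t_{s_i}\theta_\lambda=\theta_{s_i\lambda}t_{s_i}+\bigl(q^{L(s_i)/2}-q^{-L(s_i)/2}\bigr)\frac{\theta_\lambda-\theta_{s_i\lambda}}{1-\theta_{-\alpha_i^\vee}};$$ if $\alpha_i\in 2X^*$, $$t_{s_i}\theta_\lambda=\theta_{s_i\lambda}t_{s_i}+\Bigl(\bigl(q^{L(s_i)/2}-q^{-L(s_i)/2}\bigr)+\theta_{-\alpha_i^\vee}\bigl(q^{L(\tilde s_i)/2}-q^{-L(\tilde s_i)/2}\bigr)\Bigr)\frac{\theta_\lambda-\theta_{s_i\lambda}}{1-\theta_{-2\alpha_i^\vee}}.$$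
   Context: Let $(X^*,X_*,R,R^\vee,\Delta)$ be a reduced and irreducible based root datum, $\Delta$ the set of simple roots, $r=\#\Delta$, $W$ the finite Weyl group, generated by the simple reflections $s_1,\dots,s_r$, and $\widetilde W=X_*\rtimes W$ the extended affine Weyl group, acting on $X_{*,\mathbb R}=X_*\otimes\mathbb R$; $\epsilon^\lambda\in\widetilde W$ denotes the translation by $\lambda\in X_*$. Let $\alpha_0$ be the highest root, $s_0=\epsilon^{\alpha_0^\vee}s_{\alpha_0}$, $S_a=\{s_0,\dots,s_r\}$, and $W_a\subseteq\widetilde W$ the affine Weyl group generated by $S_a$. The affine root hyperplanes are $H_{\alpha,n}=\{x\in X_{*,\mathbb R}:\langle\alpha,x\rangle=n\}$ for $\alpha\in R$, $n\in\mathbb Z$. Alcoves are the connected components of the complement of their union; the base alcove $\mathbf a$ is the alcove in the dominant Weyl chamber whose closure contains the origin. The wall of type $i$ of $\mathbf a$ is the hyperplane fixed by $s_i$, and the wall of type $i$ of $x\mathbf a$ ($x\in W_a$) is its image under $x$. Length function on $\widetilde W$: $\ell(w\epsilon^\lambda)=\sum_{\alpha>0,\,w(\alpha)<0}|\langle\alpha,\lambda\rangle+1|+\sum_{\alpha>0,\,w(\alpha)>0}|\langle\alpha,\lambda\rangle|$. $\Omega\subseteq\widetilde W$ is the subgroup of elements of length $0$. A parameter system is a function $L:\widetilde W\to\mathbb Z_{\ge0}$ with $L(ww')=L(w)+L(w')$ whenever $\ell(ww')=\ell(w)+\ell(w')$. Fix a commutative ring $k$, an invertible $v\in k$, put $q=v^2$,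 $q^{1/2}=v$. The Hecke algebra $\mathcal H$ with parameters $L$ is the quotient of the group algebra over $k$ of the braid group of $\widetilde W$ (generators $T_w$, $w\in\widetilde W$; relations $T_wT_{w'}=T_{ww'}$ whenever $\ell(ww')=\ell(w)+\ell(w')$) by the two-sided ideal generated by $(T_s+1)(T_s-q^{L(s)})$, $s\in S_a$. Put $\tilde T_i=q^{-L(s_i)/2}T_{s_i}$. If $\alpha_i\in2X^*$, then $(W_a,S_a)$ is of type $\tilde C_r$ (type $\tilde A_1$ if $r=1$), and $\tilde s_i$ denotes the affine simple reflection $s_0$. Alcove walks. We use the standard orientation: for each positive root $\alpha$ and $j\in\mathbb Z$ the positive side of $H_{\alpha,j}$ is $\{x:\langle\alpha,x\rangle>j\}$ and the negative side is $\{x:\langle\alpha,x\rangle<j\}$. A non-folded alcove walk is a formal product $c_{i_1}^{\varepsilon_1}\cdots c_{i_n}^{\varepsilon_n}t_\sigma$ with $i_\nu\in\{0,\dots,r\}$, $\sigma\in\Omega$, where for each $\nu$, with $x_\nu=s_{i_1}\cdots s_{i_{\nu-1}}$, the sign $\varepsilon_\nu$ is $+$ if $x_\nu\mathbf a$ is on the negative side of its wall of type $i_\nu$ and $-$ if it is on the positive side. Its end point is $s_{i_1}\cdots s_{i_n}\sigma\in\widetilde W$. The map $\Phi$ sends $c_i^+\mapsto\tilde T_i$, $c_i^-\mapsto\tilde T_i^{-1}$, $t_\sigma\mapsto T_\sigma$, multiplicatively, with values in $\mathcal H$. The image under $\Phi$ of a non-folded alcove walk depends only on its end point. For $w\in W$,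 $t_w:=\Phi(p)^{-1}$, where $p$ is a non-folded alcove walk with end point $w^{-1}$. For $\lambda\in X_*$, $\theta_\lambda:=\Phi(p)$, where $p$ is a non-folded alcove walk with end point $\epsilon^\lambda$. The fractions are understood as the usual finite sums. With $n=\langle\alpha_i,\lambda\rangle$: $\frac{\theta_\lambda-\theta_{s_i\lambda}}{1-\theta_{-\alpha_i^\vee}}$ is $\sum_{m=0}^{n-1}\theta_{\lambda-m\alpha_i^\vee}$ if $n\ge0$ and $-\sum_{m=1}^{-n}\theta_{\lambda+m\alpha_i^\vee}$ if $n<0$; and when $\alpha_i\in2X^*$ (so $n$ is even), $\frac{\theta_\lambda-\theta_{s_i\lambda}}{1-\theta_{-2\alpha_i^\vee}}$ is $\sum_{m=0}^{n/2-1}\theta_{\lambda-2m\alpha_i^\vee}$ if $n\ge0$ and $-\sum_{m=1}^{-n/2}\theta_{\lambda+2m\alpha_i^\vee}$ if $n<0$. *)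

(* Defs.v *)
From HB Require Import structures.
From mathcomp Require Import all_boot all_order all_algebra.
From mathcomp Require Import finmap ring_quotient generic_quotient.
From mathcomp Require Import boolp classical_sets reals topology normedtype.

Set Implicit Arguments.
Unset Strict Implicit.
Unset Printing Implicit Defensive.

Import Order.TTheory GRing.Theory Num.Theory.
Import numFieldNormedType.Exports.

Local Open Scope classical_set_scope.
Local Open Scope quotient_scope.
Local Open Scope ring_scope.

Section PresentedGroup.
Variables (I : choiceType).

(** A letter [(x, true)] is the generator [x], [(x, false)] its inverse. *)
Definition word := seq (I * bool).

Definition inv_letter (c : I * bool) : I * bool := (c.1, ~~ c.2).

Definition inv_word (s : word) : word := rev (map inv_letter s).

Variable (rel : word -> word -> Prop).

Inductive word_eq : word -> word -> Prop :=
| WordRel s t : rel s t -> word_eq s t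
| WordCancel c : word_eq [:: c; inv_letter c] [::]
| WordRefl s : word_eq s s
| WordSym s t : word_eq s t -> word_eq t s
| WordTrans s t u : word_eq s t -> word_eq t u -> word_eq s u
| WordCat s t s' t' :
    word_eq s t -> word_eq s' t' -> word_eq (s ++ s') (t ++ t').

Definition word_eqb (s t : word) : bool := `[< word_eq s t >].

Lemma word_eqb_refl : reflexive word_eqb.
Proof. by move=> s; apply/asboolP; exact: WordRefl. Qed.

Lemma word_eqb_sym : symmetric word_eqb.
Proof.
by move=> s t; apply/asboolP/asboolP; exact: WordSym.
Qed.

Lemma word_eqb_trans : transitive word_eqb.
Proof.
by move=> t s u /asboolP st /asboolP tu; apply/asboolP; exact: WordTrans tu.
Qed.

Canonical word_equiv :=
  EquivRel word_eqb word_eqb_refl word_eqb_sym word_eqb_trans.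

Definition presented := {eq_quot word_eqb}.
HB.instance Definition _ := Choice.on presented.

Definition of_word (s : word) : presented := \pi_presented s.

Lemma of_wordP s t : of_word s = of_word t <-> word_eq s t.
Proof. by split=> [/eqmodP/asboolP|st]; last exact/eqmodP/asboolP. Qed.

Lemma of_wordK (x : presented) : of_word (repr x) = x.
Proof. exact: reprK. Qed.

Lemma repr_of_word s : word_eq (repr (of_word s)) s.
Proof. by apply/of_wordP; rewrite of_wordK. Qed.

Lemma inv_letterK : involutive inv_letter.
Proof. by case=> x b; rewrite /inv_letter /= negbK. Qed.

Lemma inv_wordK : involutive inv_word.
Proof.
by move=> s; rewrite /inv_word map_rev revK -map_comp map_id_in // => c _;
  exact: inv_letterK.
Qed.

Lemma word_mulV s : word_eq (s ++ inv_word s) [::].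
Proof.
elim: s => [|c s IHs]; first exact: WordRefl.
rewrite /inv_word map_cons rev_cons -cats1 -/(inv_word s) catA.
rewrite -[c :: s]/([:: c] ++ s) -(catA [:: c]).
apply: (@WordTrans _ ([:: c] ++ [:: inv_letter c])); last exact: WordCancel.
apply: (@WordCat _ [:: c]); last exact: WordRefl.
by rewrite -{2}[[:: c]]cats0; apply: WordCat => //; exact: WordRefl.
Qed.

Lemma word_mulN s : word_eq (inv_word s ++ s) [::].
Proof. by rewrite -{2}[s]inv_wordK; exact: word_mulV. Qed.

Definition pmul (x y : presented) : presented := of_word (repr x ++ repr y).
Definition pone : presented := of_word [::].
Definition pinv (x : presented) : presented := of_word (inv_word (repr x)).

Lemma of_word_cat s t : of_word (s ++ t) = pmul (of_word s) (of_word t).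
Proof.
by apply/of_wordP/WordSym; apply: WordCat; exact: repr_of_word.
Qed.

Lemma pmulA : associative pmul.
Proof.
move=> x y z; rewrite -[x]of_wordK -[y]of_wordK -[z]of_wordK.
by rewrite -!of_word_cat catA.
Qed.

Lemma pmul1 : left_id pone pmul.
Proof. by move=> x; rewrite -[x]of_wordK -of_word_cat. Qed.

Lemma pmulr1 : right_id pone pmul.
Proof. by move=> x; rewrite -[x]of_wordK -of_word_cat cats0. Qed.

Lemma pmulN : left_inverse pone pinv pmul.
Proof.
by move=> x; rewrite -{2}[x]of_wordK -of_word_cat; apply/of_wordP/word_mulN.
Qed.

Lemma pmulV : right_inverse pone pinv pmul.
Proof.
by move=> x; rewrite -{1}[x]of_wordK -of_word_cat; apply/of_wordP/word_mulV.
Qed.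

HB.instance Definition _ := isGroup.Build presented
  pmulA pmul1 pmulr1 pmulN pmulV.

End PresentedGroup.

Section GroupAlgebra.
Variables (k : comPzRingType) (G : groupType).

Definition group_algebra := {fsfun G -> k with 0}.
HB.instance Definition _ := Choice.on group_algebra.
Implicit Types f g h : group_algebra.

Definition gadd f g : group_algebra :=
  [fsfun x in (finsupp f `|` finsupp g)%fset => f x + g x].

Definition gopp f : group_algebra := [fsfun x in finsupp f => - f x].

Definition gscale (c : k) f : group_algebra := [fsfun x in finsupp f => c * f x].

Definition gbasis (x : G) : group_algebra := [fsfun y in [fset x]%fset => 1].

Definition gmul f g : group_algebra :=
  [fsfun z in [fset (x * y)%g | x in finsupp f, y in finsupp g]%fset =>
    \sum_(x <- finsupp f) f x * g (x^-1 * z)%g].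

Lemma gaddE f g x : gadd f g x = f x + g x.
Proof.
rewrite fsfunE in_fsetU; case: ifP => // /negbT.
by rewrite negb_or => /andP[/fsfun_dflt-> /fsfun_dflt->]; rewrite addr0.
Qed.

Lemma goppE f x : gopp f x = - f x.
Proof. by rewrite fsfunE; case: finsuppP => // _; rewrite oppr0. Qed.

Lemma gscaleE c f x : gscale c f x = c * f x.
Proof. by rewrite fsfunE; case: finsuppP => // _; rewrite mulr0. Qed.

Lemma gbasisE x y : gbasis x y = (x == y)%:R.
Proof. by rewrite fsfunE in_fset1 eq_sym; case: eqP. Qed.

Lemma gbasis_supp x : {subset finsupp (gbasis x) <= [:: x]}.
Proof.
move=> y; rewrite mem_finsupp gbasisE inE (eq_sym y).
by case: (x == y) => //; rewrite eqxx.
Qed.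

Lemma gmulE f g z : gmul f g z = \sum_(x <- finsupp f) f x * g (x^-1 * z)%g.
Proof.
rewrite fsfunE; case: ifP => // /negbT nz; rewrite big1_seq // => x /= xf.
rewrite [g _]fsfun_dflt ?mulr0 //; apply: contra nz => yg.
by rewrite -[z](mulVKg x); exact: in_imfset2.
Qed.

Lemma gmulEw (s : seq G) f g z : uniq s -> {subset finsupp f <= s} ->
  gmul f g z = \sum_(x <- s) f x * g (x^-1 * z)%g.
Proof.
move=> us fs; rewrite gmulE (bigID (mem (finsupp f)) predT) /=.
rewrite [X in _ = X](bigID (mem (finsupp f)) predT) /=.
rewrite [X in _ + X]big1_seq ?addr0; last by move=> x /andP[/negP].
rewrite [X in _ = _ + X]big1_seq ?addr0; last first.
  by move=> x /andP[/fsfun_dflt-> _]; rewrite mul0r.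
rewrite -big_filter -[RHS]big_filter; apply: perm_big; apply: uniq_perm.
- exact/filter_uniq/fset_uniq.
- exact: filter_uniq.
- move=> x; rewrite !mem_filter.
  by case xf: (x \in finsupp f) => //=; rewrite (fs _ xf).
Qed.

Lemma gaddA : associative gadd.
Proof. by move=> f g h; apply/fsfunP => x; rewrite !gaddE addrA. Qed.

Lemma gaddC : commutative gadd.
Proof. by move=> f g; apply/fsfunP => x; rewrite !gaddE addrC. Qed.

Lemma gadd0 : left_id ([fsfun] : group_algebra) gadd.
Proof. by move=> f; apply/fsfunP => x; rewrite !gaddE fsfun0E add0r. Qed.

Lemma gaddN : left_inverse ([fsfun] : group_algebra) gopp gadd.
Proof.
by move=> f; apply/fsfunP => x; rewrite gaddE goppE fsfun0E addNr.
Qed.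

HB.instance Definition _ :=
  GRing.isZmodule.Build group_algebra gaddA gaddC gadd0 gaddN.

Lemma gmulA : associative gmul.
Proof.
move=> f g h; apply/fsfunP => z; rewrite gmulE.
pose P := [fset (x * y)%g | x in finsupp f, y in finsupp g]%fset.
have fgP : {subset finsupp (gmul f g) <= P}.
  by move=> y; apply: contraLR => yP; rewrite memNfinsupp fsfunE (negbTE yP).
rewrite (gmulEw _ _ (fset_uniq P) fgP).
under [RHS]eq_bigr do rewrite gmulE mulr_suml.
rewrite [RHS]exchange_big /=; apply: eq_big_seq => x xf.
rewrite (@gmulEw [seq (x^-1 * y)%g | y <- P]).
- rewrite big_map mulr_sumr; apply: eq_bigr => y _.
  by rewrite mulrA invgM invgK mulgA -(mulgA _ x) mulgV mulg1.
- by rewrite map_inj_uniq ?fset_uniq //; exact: mulgI.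
- move=> y yg; apply/mapP; exists (x * y)%g; last by rewrite mulKg.
  exact: in_imfset2.
Qed.

Lemma gmul1 : left_id (gbasis 1) gmul.
Proof.
move=> f; apply/fsfunP => z; rewrite (@gmulEw [:: 1%g]) //; last exact: gbasis_supp.
by rewrite big_seq1 gbasisE eqxx mul1r invg1 mul1g.
Qed.

Lemma gmulr1 : right_id (gbasis 1) gmul.
Proof.
move=> f; apply/fsfunP => z.
rewrite (@gmulEw (z |` finsupp f)%fset) ?fset_uniq // => [|x xf]; last first.
  by rewrite in_fsetU xf orbT.
rewrite (bigD1_seq z) ?fset_uniq ?in_fsetU ?in_fset1 ?eqxx //=.
rewrite gbasisE mulVg eqxx mulr1 big1 ?addr0 // => x xz.
rewrite gbasisE (_ : (1%g == _) = false) ?mulr0 //.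
by apply: contra_neqF xz => /eqP xz; rewrite -[z](mulVKg x) -xz mulg1.
Qed.

Lemma gmulDl : left_distributive gmul gadd.
Proof.
move=> f g h; apply/fsfunP => z; rewrite gaddE.
have us := fset_uniq (finsupp f `|` finsupp g `|` finsupp (gadd f g))%fset.
rewrite !(gmulEw _ _ us) -?big_split => [|x xf|x xf|x xf];
  rewrite ?in_fsetU ?xf ?orbT //=.
by apply: eq_bigr => x _; rewrite gaddE mulrDl.
Qed.

Lemma gmulDr : right_distributive gmul gadd.
Proof.
move=> f g h; apply/fsfunP => z; rewrite gaddE !gmulE -big_split /=.
by apply: eq_bigr => x _; rewrite gaddE mulrDr.
Qed.

HB.instance Definition _ :=
  GRing.Zmodule_isPzRing.Build group_algebra gmulA gmul1 gmulr1 gmulDl gmulDr.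

Lemma gscaleA a b f : gscale a (gscale b f) = gscale (a * b) f.
Proof. by apply/fsfunP => x; rewrite !gscaleE mulrA. Qed.

Lemma gscale1 : left_id 1 gscale.
Proof. by move=> f; apply/fsfunP => x; rewrite gscaleE mul1r. Qed.

Lemma gscaleDr : right_distributive gscale +%R.
Proof.
by move=> c f g; apply/fsfunP => x; rewrite gscaleE !gaddE !gscaleE mulrDr.
Qed.

Lemma gscaleDl f : {morph gscale^~ f : a b / a + b}.
Proof.
by move=> a b; apply/fsfunP => x; rewrite gscaleE gaddE !gscaleE mulrDl.
Qed.

HB.instance Definition _ := GRing.Zmodule_isLmodule.Build k group_algebra
  gscaleA gscale1 gscaleDr gscaleDl.

Lemma gscaleAl c f g : c *: (f * g) = c *: f * g.
Proof.
apply/fsfunP => z; rewrite [LHS]gscaleE [RHS](gmulEw _ _ (fset_uniq (finsupp f))).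
  by rewrite gmulE mulr_sumr; apply: eq_bigr => x _; rewrite gscaleE mulrA.
move=> x; rewrite !mem_finsupp gscaleE; apply: contra => /eqP->.
by rewrite mulr0.
Qed.

Lemma gscaleAr c f g : c *: (f * g) = f * (c *: g).
Proof.
apply/fsfunP => z; rewrite [LHS]gscaleE [RHS]gmulE gmulE mulr_sumr.
by apply: eq_bigr => x _; rewrite gscaleE mulrCA.
Qed.

Lemma gbasisM x y : gbasis (x * y)%g = gbasis x * gbasis y.
Proof.
apply/fsfunP => z; rewrite [RHS](@gmulEw [:: x]) //; last exact: gbasis_supp.
by rewrite big_seq1 !gbasisE eqxx mul1r -(inj_eq (mulgI x) y) mulVKg.
Qed.

End GroupAlgebra.

Section AlgebraQuotient.
Variables (k : comPzRingType) (G : groupType).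
Local Notation A := (group_algebra k G).
Variable S : set A.

Definition two_sided_ideal (J : set A) : Prop :=
  [/\ J 0, forall x y, J x -> J y -> J (x - y) &
      forall x y z, J y -> J (x * y * z)].

Definition gen_ideal : set A :=
  [set x | forall J, two_sided_ideal J -> S `<=` J -> J x].

Lemma gen_ideal_ideal : two_sided_ideal gen_ideal.
Proof.
split=> [J [J0 _ _] _|x y Jx Jy J idJ SJ|x y z Jy J idJ SJ] //.
- by case: (idJ) => _ JB _; apply: JB; [exact: Jx|exact: Jy].
- by case: (idJ) => _ _ JM; apply: JM; exact: Jy.
Qed.

Lemma gen_ideal_sub : S `<=` gen_ideal.
Proof. by move=> x Sx J _; exact. Qed.

Definition gen_idealb : {pred A} := fun x => `[< gen_ideal x >].

Lemma gen_idealb_zmod : zmod_closed gen_idealb.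
Proof.
have [J0 JB _] := gen_ideal_ideal.
split=> [|x y /asboolP Jx /asboolP Jy]; apply/asboolP => //.
exact: JB.
Qed.

HB.instance Definition _ :=
  GRing.isZmodClosed.Build A gen_idealb gen_idealb_zmod.

Lemma gen_idealMl x y : y \in gen_idealb -> x * y \in gen_idealb.
Proof.
have [_ _ JM] := gen_ideal_ideal.
by move=> /asboolP Jy; apply/asboolP; rewrite -[_ * _]mulr1; exact: JM.
Qed.

Lemma gen_idealMr x y : y \in gen_idealb -> y * x \in gen_idealb.
Proof.
have [_ _ JM] := gen_ideal_ideal.
by move=> /asboolP Jy; apply/asboolP; rewrite -[y]mul1r; exact: JM.
Qed.

Definition alg_quot := {ideal_quot gen_idealb}.
HB.instance Definition _ := GRing.Zmodule.on alg_quot.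

Definition alg_pi (x : A) : alg_quot := \pi_alg_quot x.

Lemma alg_piP x y : alg_pi x = alg_pi y <-> gen_ideal (x - y).
Proof.
split=> [/eqP|Jxy]; last apply/eqP; rewrite piE Quotient.equivE => //.
  by move/asboolP.
exact/asboolP.
Qed.

Lemma alg_pi_eq x y : x - y \in gen_idealb -> alg_pi x = alg_pi y.
Proof. by move/asboolP/alg_piP. Qed.

Lemma alg_piK (x : alg_quot) : alg_pi (repr x) = x.
Proof. exact: reprK. Qed.

Lemma alg_piD x y : alg_pi (x + y) = alg_pi x + alg_pi y.
Proof. by rewrite /alg_pi !piE. Qed.

Lemma alg_pi0 : alg_pi 0 = 0.
Proof. by apply: (addrI (alg_pi 0)); rewrite -alg_piD !addr0. Qed.

Lemma alg_piN x : alg_pi (- x) = - alg_pi x.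
Proof. by apply: (addrI (alg_pi x)); rewrite -alg_piD !subrr alg_pi0. Qed.

Definition qmul (x y : alg_quot) : alg_quot := alg_pi (repr x * repr y).
Definition qscale (c : k) (x : alg_quot) : alg_quot := alg_pi (c *: repr x).

Lemma alg_pi_repr x : repr (alg_pi x) - x \in gen_idealb.
Proof. by apply/asboolP/alg_piP; rewrite alg_piK. Qed.

Lemma qmulE x y : qmul (alg_pi x) (alg_pi y) = alg_pi (x * y).
Proof.
apply: alg_pi_eq; set x' := repr _; set y' := repr _.
rewrite -[_ - _](_ : (x' - x) * y' + x * (y' - y) = _); last first.
  by rewrite mulrBl mulrBr addrA subrK.
by apply: rpredD; [apply: gen_idealMr|apply: gen_idealMl]; exact: alg_pi_repr.
Qed.

Lemma qscaleE c x : qscale c (alg_pi x) = alg_pi (c *: x).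
Proof.
apply: alg_pi_eq; rewrite -scalerBr -[_ - _]mul1r gscaleAl.
by apply: gen_idealMl; exact: alg_pi_repr.
Qed.

Lemma qmulA : associative qmul.
Proof.
by move=> x y z; rewrite -[x]alg_piK -[y]alg_piK -[z]alg_piK !qmulE mulrA.
Qed.

Lemma qmul1 : left_id (alg_pi 1) qmul.
Proof. by move=> x; rewrite -[x]alg_piK qmulE mul1r. Qed.

Lemma qmulr1 : right_id (alg_pi 1) qmul.
Proof. by move=> x; rewrite -[x]alg_piK qmulE mulr1. Qed.

Lemma qmulDl : left_distributive qmul +%R.
Proof.
move=> x y z; rewrite -[x]alg_piK -[y]alg_piK -[z]alg_piK.
by rewrite -alg_piD !qmulE mulrDl alg_piD.
Qed.

Lemma qmulDr : right_distributive qmul +%R.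
Proof.
move=> x y z; rewrite -[x]alg_piK -[y]alg_piK -[z]alg_piK.
by rewrite -alg_piD !qmulE mulrDr alg_piD.
Qed.

HB.instance Definition _ :=
  GRing.Zmodule_isPzRing.Build alg_quot qmulA qmul1 qmulr1 qmulDl qmulDr.

Lemma qscaleA a b x : qscale a (qscale b x) = qscale (a * b) x.
Proof. by rewrite -[x]alg_piK !qscaleE scalerA. Qed.

Lemma qscale1 : left_id 1 qscale.
Proof. by move=> x; rewrite -[x]alg_piK qscaleE scale1r. Qed.

Lemma qscaleDr : right_distributive qscale +%R.
Proof.
move=> c x y; rewrite -[x]alg_piK -[y]alg_piK -alg_piD !qscaleE -alg_piD.
by rewrite scalerDr.
Qed.

Lemma qscaleDl x : {morph qscale^~ x : a b / a + b}.
Proof.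
by move=> a b; rewrite -[x]alg_piK !qscaleE -alg_piD scalerDl.
Qed.

HB.instance Definition _ := GRing.Zmodule_isLmodule.Build k alg_quot
  qscaleA qscale1 qscaleDr qscaleDl.

Lemma alg_piM x y : alg_pi (x * y) = alg_pi x * alg_pi y.
Proof. by rewrite [LHS](esym (qmulE x y)). Qed.

Lemma alg_piZ c x : alg_pi (c *: x) = c *: alg_pi x.
Proof. by rewrite [LHS](esym (qscaleE c x)). Qed.

Lemma qscaleAl (c : k) (x y : alg_quot) : c *: (x * y) = c *: x * y.
Proof.
by rewrite -[x]alg_piK -[y]alg_piK -alg_piM -!alg_piZ -alg_piM gscaleAl.
Qed.

Lemma qscaleAr (c : k) (x y : alg_quot) : c *: (x * y) = x * (c *: y).
Proof.
by rewrite -[x]alg_piK -[y]alg_piK -alg_piM -!alg_piZ -alg_piM gscaleAr.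
Qed.

End AlgebraQuotient.

Definition pz_inv (A : pzRingType) (x : A) : A :=
  xget 0 [set y | x * y = 1 /\ y * x = 1].

Definition free_of_finite_rank (M : zmodType) : Prop :=
  exists (n : nat) (e : 'I_n -> M),
    forall x : M, exists! c : {ffun 'I_n -> int}, x = \sum_i e i *~ c i.

Record based_root_datum := BasedRootDatum {
  chars : zmodType;
  cochars : zmodType;
  pair : chars -> cochars -> int;
  pairDl : forall x x' y, pair (x + x') y = pair x y + pair x' y;
  pairDr : forall x y y', pair x (y + y') = pair x y + pair x y';
  chars_free : free_of_finite_rank chars;
  cochars_free : free_of_finite_rank cochars;
  pair_perfectl : forall f : {additive cochars -> int},
    exists! x, forall y, pair x y = f y;
  pair_perfectr : forall f : {additive chars -> int},
    exists! y, forall x, pair x y = f x;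
  roots : seq chars;
  coroot : chars -> cochars;
  roots_uniq : uniq roots;
  coroot_inj : {in roots &, injective coroot};
  pair_coroot : forall a, a \in roots -> pair a (coroot a) = 2;
  refl_roots : forall a b, a \in roots -> b \in roots ->
    b - a *~ pair b (coroot a) \in roots;
  refl_coroots : forall a b, a \in roots -> b \in roots ->
    coroot b - coroot a *~ pair a (coroot b) \in map coroot roots;
  nsimple : nat;
  simple : 'I_nsimple -> chars;
  simple_root : forall i, simple i \in roots;
  simple_free : forall c : 'I_nsimple -> int,
    \sum_i simple i *~ c i = 0 -> forall i, c i = 0;
  simple_gen : forall a, a \in roots -> exists c : 'I_nsimple -> nat,
    a = \sum_i simple i *+ c i \/ a = - (\sum_i simple i *+ c i)
}.

Section RootDatum.
Variable D : based_root_datum.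
Local Notation X := (chars D).
Local Notation Y := (cochars D).
Local Notation R := (roots D).

Definition reduced : Prop :=
  forall (a b : X) (m n : int), a \in R -> b \in R ->
    m != 0 -> a *~ m = b *~ n -> b = a \/ b = - a.

Definition irreducible : Prop :=
  (exists a, a \in R) /\
  forall P : pred X,
    {in R &, forall a b, P a -> ~~ P b -> pair a (coroot b) = 0} ->
    {in R, forall a, P a} \/ {in R, forall a, ~~ P a}.

Definition nonneg_comb (x : X) : bool :=
  `[< exists c : 'I_(nsimple D) -> nat, x = \sum_i simple i *+ c i >].

Definition positive (a : X) : bool := (a \in R) && nonneg_comb a.
Definition negative (a : X) : bool := positive (- a).

Record highest_root := HighestRoot {
  hroot :> X;
  hroot_root : hroot \in R;
  hroot_max : forall b, b \in R -> nonneg_comb (hroot - b)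
}.

Definition refl (a : X) (x : X) : X := x - a *~ pair x (coroot a).
Definition corefl (a : X) (y : Y) : Y := y - coroot a *~ pair a y.

(** The Weyl group acts faithfully on [X] and on [Y]; an element is the pair
    of its two actions. The group is generated by all reflections [s_a], [a] a
    root; the simple ones generate it as well. *)
Inductive in_weyl : (X -> X) -> (Y -> Y) -> Prop :=
| WeylId : in_weyl id id
| WeylRefl a f g : a \in R -> in_weyl f g ->
    in_weyl (refl a \o f) (corefl a \o g).

Record weyl := Weyl {
  wX : X -> X;
  wY : Y -> Y;
  weylP : in_weyl wX wY
}.

HB.instance Definition _ := gen_eqMixin weyl.
HB.instance Definition _ := gen_choiceMixin weyl.

Lemma weyl_eq (u w : weyl) : wX u = wX w -> wY u = wY w -> u = w.
Proof.
case: u => f g p; case: w => f' g' p' /= ff gg.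
by move: p p'; rewrite ff gg => p p'; rewrite (Prop_irrelevance p p').
Qed.

Lemma in_weyl_comp f g f' g' :
  in_weyl f g -> in_weyl f' g' -> in_weyl (f \o f') (g \o g').
Proof.
move=> fg fg'; elim: fg => [|a f1 g1 aR _ IH] //.
exact: (@WeylRefl a (f1 \o f') (g1 \o g')).
Qed.

Lemma pairNl (x : X) (y : Y) : pair (- x) y = - pair x y.
Proof.
by apply: (addrI (pair x y)); rewrite -pairDl !subrr; apply: (addrI (pair 0 y));
  rewrite -pairDl !addr0.
Qed.

Lemma pairNr (x : X) (y : Y) : pair x (- y) = - pair x y.
Proof.
by apply: (addrI (pair x y)); rewrite -pairDr !subrr; apply: (addrI (pair x 0));
  rewrite -pairDr !addr0.
Qed.

Lemma pairMzl (x : X) (y : Y) (n : int) : pair (x *~ n) y = pair x y * n.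
Proof.
have p0 : pair (0 : X) y = 0.
  by apply: (addrI (pair 0 y)); rewrite -pairDl !addr0.
have pn (m : nat) : pair (x *+ m) y = pair x y * m%:Z.
  by elim: m => [|m IH]; rewrite ?mulr0 // mulrS pairDl IH intS mulrDr mulr1.
by case: n => m; rewrite ?NegzE ?mulrNz ?pairNl -?pmulrn pn ?mulrN.
Qed.

Lemma pairMzr (x : X) (y : Y) (n : int) : pair x (y *~ n) = pair x y * n.
Proof.
have p0 : pair x (0 : Y) = 0.
  by apply: (addrI (pair x 0)); rewrite -pairDr !addr0.
have pn (m : nat) : pair x (y *+ m) = pair x y * m%:Z.
  by elim: m => [|m IH]; rewrite ?mulr0 // mulrS pairDr IH intS mulrDr mulr1.
by case: n => m; rewrite ?NegzE ?mulrNz ?pairNr -?pmulrn pn ?mulrN.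
Qed.

Lemma reflK a : a \in R -> involutive (refl a).
Proof.
move=> aR x; rewrite /refl pairDl pairNl pairMzl (pair_coroot aR).
rewrite -[x in RHS]addr0 -addrA; congr (_ + _).
by rewrite -opprD -mulrzDr mulr_natl mulr2n addrA subrr mulr0z oppr0.
Qed.

Lemma coreflK a : a \in R -> involutive (corefl a).
Proof.
move=> aR x; rewrite /corefl pairDr pairNr pairMzr (pair_coroot aR).
rewrite -[x in RHS]addr0 -addrA; congr (_ + _).
by rewrite -opprD -mulrzDr mulr_natl mulr2n addrA subrr mulr0z oppr0.
Qed.

Lemma in_weyl_inv f g : in_weyl f g -> exists f' g',
  [/\ in_weyl f' g', cancel f f', cancel f' f, cancel g g' & cancel g' g].
Proof.
elim=> [|a f1 g1 aR _ [f' [g' [p fK f'K gK g'K]]]].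
  by exists id, id; split=> //; exact: WeylId.
exists (f' \o refl a), (g' \o corefl a); split.
- apply: in_weyl_comp => //.
  exact: (@WeylRefl a id id aR WeylId).
- by move=> x /=; rewrite reflK.
- by move=> x /=; rewrite f'K reflK.
- by move=> x /=; rewrite coreflK.
- by move=> x /=; rewrite g'K coreflK.
Qed.

Definition weyl_one : weyl := Weyl WeylId.
Definition weyl_mul (u w : weyl) : weyl := Weyl (in_weyl_comp (weylP u) (weylP w)).

Lemma weyl_inv_exists (w : weyl) :
  exists u, weyl_mul u w = weyl_one /\ weyl_mul w u = weyl_one.
Proof.
have [f' [g' [p fK f'K gK g'K]]] := in_weyl_inv (weylP w).
by exists (Weyl p); split; apply: weyl_eq; apply/funext => x /=.
Qed.

Definition weyl_inv (w : weyl) : weyl := sval (cid (weyl_inv_exists w)).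

Lemma weyl_mulA : associative weyl_mul.
Proof. by move=> u w z; exact: weyl_eq. Qed.

Lemma weyl_mul1 : left_id weyl_one weyl_mul.
Proof. by move=> w; exact: weyl_eq. Qed.

Lemma weyl_mulr1 : right_id weyl_one weyl_mul.
Proof. by move=> w; exact: weyl_eq. Qed.

Lemma weyl_mulN : left_inverse weyl_one weyl_inv weyl_mul.
Proof. by move=> w; rewrite /weyl_inv; case: cid => u []. Qed.

Lemma weyl_mulV : right_inverse weyl_one weyl_inv weyl_mul.
Proof. by move=> w; rewrite /weyl_inv; case: cid => u []. Qed.

HB.instance Definition _ := isGroup.Build weyl
  weyl_mulA weyl_mul1 weyl_mulr1 weyl_mulN weyl_mulV.

Definition weyl_refl (a : X) (aR : a \in R) : weyl :=
  Weyl (WeylRefl aR WeylId).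

(** [AffWeyl y w] is the element [epsilon^y w], that is, the transformation
    [z |-> y + w z]. *)
Record aff_weyl := AffWeyl { atrans : Y; alin : weyl }.

HB.instance Definition _ := gen_eqMixin aff_weyl.
HB.instance Definition _ := gen_choiceMixin aff_weyl.

Definition aff_one : aff_weyl := AffWeyl 0 1%g.
Definition aff_mul (x y : aff_weyl) : aff_weyl :=
  AffWeyl (atrans x + wY (alin x) (atrans y)) (alin x * alin y)%g.
Definition aff_inv (x : aff_weyl) : aff_weyl :=
  AffWeyl (- wY (alin x)^-1%g (atrans x)) (alin x)^-1%g.

Lemma wYD (w : weyl) y z : wY w (y + z) = wY w y + wY w z.
Proof.
case: w => f g /=; elim=> [|a f1 g1 aR _ IH] //=.
by rewrite IH /corefl pairDr mulrzDr opprD addrACA.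
Qed.

Lemma wY0 (w : weyl) : wY w 0 = 0.
Proof. by apply: (addrI (wY w 0)); rewrite -wYD !addr0. Qed.

Lemma wYM (u w : weyl) y : wY (u * w)%g y = wY u (wY w y).
Proof. by []. Qed.

Lemma wY1 y : wY 1%g y = y. Proof. by []. Qed.

Lemma wYN (w : weyl) y : wY w (- y) = - wY w y.
Proof. by apply: (addrI (wY w y)); rewrite -wYD !subrr wY0. Qed.

Lemma aff_mulA : associative aff_mul.
Proof.
by move=> x y z; rewrite /aff_mul /= wYD addrA mulgA.
Qed.

Lemma aff_mul1 : left_id aff_one aff_mul.
Proof. by case=> y w; rewrite /aff_mul /= add0r mul1g. Qed.

Lemma aff_mulr1 : right_id aff_one aff_mul.
Proof. by case=> y w; rewrite /aff_mul /= wY0 addr0 mulg1. Qed.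

Lemma aff_mulN : left_inverse aff_one aff_inv aff_mul.
Proof. by case=> y w; rewrite /aff_mul /= addNr mulVg. Qed.

Lemma aff_mulV : right_inverse aff_one aff_inv aff_mul.
Proof.
case=> y w; rewrite /aff_mul /= wYN mulgV.
by rewrite -[wY w (wY _ _)]/(wY (w * w^-1)%g y) mulgV subrr.
Qed.

HB.instance Definition _ := isGroup.Build aff_weyl
  aff_mulA aff_mul1 aff_mulr1 aff_mulN aff_mulV.

Definition transl (y : Y) : aff_weyl := AffWeyl y 1%g.
Definition lin (w : weyl) : aff_weyl := AffWeyl 0 w.

(** The length formula is that of [w epsilon^l]; here
    [epsilon^y w = w epsilon^(w^-1 y)]. *)
Definition aff_length (x : aff_weyl) : nat :=
  let w := alin x in
  let l := wY w^-1%g (atrans x) in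
  ((\sum_(a <- R | positive a && negative (wX w a)) absz (pair a l + 1)%R) +
   (\sum_(a <- R | positive a && positive (wX w a)) absz (pair a l)))%N.

Definition omega : set aff_weyl := [set x | aff_length x = 0%N].

Definition parameter_system (L : aff_weyl -> nat) : Prop :=
  forall x y, aff_length (x * y)%g = (aff_length x + aff_length y)%N ->
    L (x * y)%g = (L x + L y)%N.

Definition simple_refl (i : 'I_(nsimple D)) : weyl := weyl_refl (simple_root i).

Variable a0 : highest_root.

(** The affine simple reflection [s_0] has index [ord0], and the simple
    reflection attached to [simple i] has index [lift ord0 i]. *)
Definition aff_refl (i : 'I_(nsimple D).+1) : aff_weyl :=
  match unlift ord0 i with
  | Some j => lin (simple_refl j)
  | None => (transl (coroot a0) * lin (weyl_refl (hroot_root a0)))%g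
  end.

Section Alcoves.
Variable K : realType.

(** As the pairing is perfect, [Y (x) K] is the space of additive functions
    [X -> K], where [y (x) c] is the function [x |-> c <x, y>]; pointwise
    convergence induces its usual topology. *)
Definition space : set {ptws X -> K} :=
  [set p | forall x x' : X, p (x + x') = p x + p x'].

Definition aff_act (x : aff_weyl) (p : {ptws X -> K}) : {ptws X -> K} :=
  fun c => (pair c (atrans x))%:~R + p (wX (alin x)^-1%g c).

Definition hyperplane (a : X) (n : int) : set {ptws X -> K} :=
  [set p | space p /\ p a = n%:~R].

Definition hyperplane_compl : set {ptws X -> K} :=
  [set p | space p /\
           forall (a : X) (n : int), a \in R -> ~ hyperplane a n p].

Definition alcove (A : set {ptws X -> K}) : Prop :=
  exists2 p, hyperplane_compl p & A = connected_component hyperplane_compl p.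

Definition dominant_chamber : set {ptws X -> K} :=
  [set p | space p /\ forall i, 0 < p (simple i)].

(** Exactly one alcove satisfies the condition. *)
Definition base_alcove : set {ptws X -> K} :=
  xget set0 [set A | [/\ alcove A, A `<=` dominant_chamber &
                         closure A (fun=> 0)]].

Definition base_wall (i : 'I_(nsimple D).+1) : set {ptws X -> K} :=
  [set p | space p /\ aff_act (aff_refl i) p = p].

Definition wall (x : aff_weyl) (i : 'I_(nsimple D).+1) : set {ptws X -> K} :=
  aff_act x @` base_wall i.

Definition on_positive_side (x : aff_weyl) (i : 'I_(nsimple D).+1) : Prop :=
  exists (a : X) (j : int), [/\ positive a, wall x i = hyperplane a j &
    aff_act x @` base_alcove `<=` [set p | j%:~R < p a]].

Definition on_negative_side (x : aff_weyl) (i : 'I_(nsimple D).+1) : Prop :=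
  exists (a : X) (j : int), [/\ positive a, wall x i = hyperplane a j &
    aff_act x @` base_alcove `<=` [set p | p a < j%:~R]].

(** [([:: (i_1, e_1); ...; (i_n, e_n)], s)] stands for the formal product
    [c_(i_1)^(e_1) ... c_(i_n)^(e_n) t_s], where [true] is the sign [+]. *)
Definition walk := (seq ('I_(nsimple D).+1 * bool) * aff_weyl)%type.
HB.instance Definition _ := Choice.on walk.

Fixpoint nonfolded_from (x : aff_weyl) (s : seq ('I_(nsimple D).+1 * bool)) :
    Prop :=
  match s with
  | [::] => True
  | (i, e) :: s' =>
      (if e then on_negative_side x i else on_positive_side x i) /\
      nonfolded_from (x * aff_refl i)%g s'
  end.

Definition nonfolded (p : walk) : Prop :=
  nonfolded_from 1%g p.1 /\ omega p.2.

Definition endpoint (p : walk) : aff_weyl :=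
  (\prod_(c <- p.1) aff_refl c.1 * p.2)%g.

(** A choice of walk: such walks exist for every [x], and [Phi] takes the same
    value on all of them. *)
Definition walk_to (x : aff_weyl) : walk :=
  xget ([::], 1%g) [set p | nonfolded p /\ endpoint p = x].

End Alcoves.

Definition braid_rel (s t : word aff_weyl) : Prop :=
  exists x y, [/\ aff_length (x * y)%g = (aff_length x + aff_length y)%N,
    s = [:: (x, true); (y, true)] & t = [:: ((x * y)%g, true)]].

Definition braid_group := presented braid_rel.
HB.instance Definition _ := Group.on braid_group.

Definition braid_gen (x : aff_weyl) : braid_group := of_word braid_rel [:: (x, true)].

Section Hecke.
Variables (k : comPzRingType) (v : k) (L : aff_weyl -> nat).

(** [q = v ^+ 2]. *)
Definition hecke_rel : set (group_algebra k braid_group) :=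
  [set z | exists i, let T := gbasis k (braid_gen (aff_refl i)) in
    z = (T + 1) * (T - (v ^+ 2) ^+ L (aff_refl i) *: (1 : group_algebra k braid_group))].

Definition hecke := alg_quot hecke_rel.
HB.instance Definition _ := GRing.PzRing.on hecke.
HB.instance Definition _ := GRing.Lmodule.on hecke.

Definition hecke_T (x : aff_weyl) : hecke :=
  alg_pi hecke_rel (gbasis k (braid_gen x)).

Lemma hecke_TM x y : aff_length (x * y)%g = (aff_length x + aff_length y)%N ->
  hecke_T x * hecke_T y = hecke_T (x * y)%g.
Proof.
move=> xy; rewrite /hecke_T -alg_piM -gbasisM; congr (alg_pi _ (gbasis k _)).
rewrite /braid_gen -[LHS]/(pmul _ _) -of_word_cat; apply/of_wordP/WordRel.
by exists x, y.
Qed.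

Lemma hecke_T_inv x : exists y : hecke, hecke_T x * y = 1 /\ y * hecke_T x = 1.
Proof.
exists (alg_pi hecke_rel (gbasis k (braid_gen x)^-1%g)).
by rewrite -!alg_piM -!gbasisM mulgV mulVg.
Qed.

Lemma hecke_T_quadratic i : let T := hecke_T (aff_refl i) in
  (T + 1) * (T - (v ^+ 2) ^+ L (aff_refl i) *: (1 : hecke)) = 0.
Proof.
have pi1 : 1 = alg_pi hecke_rel 1 by [].
rewrite /= pi1 -alg_piZ -alg_piN -!alg_piD -alg_piM -(alg_pi0 hecke_rel).
by apply/alg_piP; rewrite subr0; apply: gen_ideal_sub; exists i.
Qed.

(** The inverse of [v], that is, [q ^ (-1/2)]. *)
Variable vV : k.

Definition hecke_Tn (i : 'I_(nsimple D).+1) : hecke :=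
  vV ^+ L (aff_refl i) *: hecke_T (aff_refl i).

Definition Phi (p : walk) : hecke :=
  (\prod_(c <- p.1) if c.2 then hecke_Tn c.1 else pz_inv (hecke_Tn c.1)) *
  hecke_T p.2.

Variable K : realType.

Definition tW (w : weyl) : hecke := pz_inv (Phi (walk_to K (lin w^-1%g))).

Definition theta (y : Y) : hecke := Phi (walk_to K (transl y)).

(** [theta_frac y b n] is the fraction
    [(theta y - theta (y - b *~ n)) / (1 - theta (- b))]. *)
Definition theta_frac (y b : Y) (n : int) : hecke :=
  if 0 <= n then \sum_(0 <= m < absz n) theta (y - b *+ m)
  else - \sum_(1 <= m < (absz n).+1) theta (y + b *+ m).

End Hecke.

Definition in_double (x : X) : Prop := exists y : X, x = y *+ 2.

End RootDatum.

(* Main.v *)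
(* Write [T~_x] for [q^(-L(x)/2) T_x] and let [rho] be a strictly dominant
   cocharacter. Seen from an alcove far inside the antidominant chamber, a
   crossing is positive exactly when it increases the length. Hence
   [T~_(N rho) Phi(p) = T~_(epsilon^(N rho) x)] for every nonfolded walk [p] with
   end point [x] and all large [N], so that [Phi(p)] is a function [Psi x] of the
   end point, and [theta] is multiplicative.

   A walk from the base alcove to [x], reflected by [s_i], keeps its signs except
   where it crosses a hyperplane [H_(alpha_i, m)]. Correcting these signs one
   after the other with [T~_j = T~_j^-1 + (q^(L(s_j)/2) - q^(-L(s_j)/2))] gives
     [T~_i^-1 Psi(x) = Psi(s_i x) + sum_m q_m Psi(epsilon^(-m alpha_i^vee) x)],
   where [m] runs through the crossed hyperplanes and [q_m] is the constant of the
   type of the wall at [H_(alpha_i, m)]; [x = epsilon^lambda] is the theorem. The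
   reflection in [H_(alpha_i, m)] is conjugate to [s_i] whenever [m] is a value of
   [alpha_i]; if [alpha_i] is in [2 X], then for odd [m] the wall has type 0. *)

Require Import Defs.
From HB Require Import structures.
From mathcomp Require Import all_boot all_order all_algebra.
From mathcomp Require Import zify ring lra.
From mathcomp Require Import mathcomp_extra boolp classical_sets functions.
From mathcomp Require Import reals topology normedtype.

Set Implicit Arguments.
Unset Strict Implicit.
Unset Printing Implicit Defensive.

Import Order.TTheory GRing.Theory Num.Theory.
Import numFieldNormedType.Exports.

Local Open Scope ring_scope.

(** * Roots and coroots *)

Section Pairing.
Variable D : based_root_datum.
Local Notation X := (chars D).
Local Notation Y := (cochars D).
Local Notation R := (Defs.roots D).
Local Notation pairl y := (fun x : X => pair x y).
Implicit Types (a b c : X) (y z : Y) (w u : weyl D).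

Lemma pair0l y : pair (0 : X) y = 0.
Proof. by apply: (addrI (pair (0 : X) y)); rewrite -pairDl !addr0. Qed.

Lemma pair0r (x : X) : pair x (0 : Y) = 0.
Proof. by apply: (addrI (pair x (0 : Y))); rewrite -pairDr !addr0. Qed.

Lemma pairBl (x x' : X) y : pair (x - x') y = pair x y - pair x' y.
Proof. by rewrite pairDl pairNl. Qed.

Lemma pairBr (x : X) y z : pair x (y - z) = pair x y - pair x z.
Proof. by rewrite pairDr pairNr. Qed.

Lemma pairMnl (x : X) y (n : nat) : pair (x *+ n) y = pair x y * n%:Z.
Proof. by rewrite pmulrn pairMzl. Qed.

Lemma pairMnr (x : X) y (n : nat) : pair x (y *+ n) = pair x y * n%:Z.
Proof. by rewrite pmulrn pairMzr. Qed.

Definition pairlE := (pairDl, pairNl, pairMzl, pairMnl).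

Definition pairrE := (pairDr, pairNr, pairMzr, pairMnr).

Lemma pair_suml (I : Type) (r : seq I) (F : I -> X) y :
  pair (\sum_(i <- r) F i) y = \sum_(i <- r) pair (F i) y.
Proof.
by elim/big_rec2: _ => [|i p q _ <-]; rewrite ?pair0l ?pairDl.
Qed.

Lemma pair_sumr (I : Type) (r : seq I) (F : I -> Y) (x : X) :
  pair x (\sum_(i <- r) F i) = \sum_(i <- r) pair x (F i).
Proof.
by elim/big_rec2: _ => [|i p q _ <-]; rewrite ?pair0r ?pairDr.
Qed.

Lemma pair_of_additive (f : Y -> int) : {morph f : y z / y - z} ->
  exists! x : X, forall y, pair x y = f y.
Proof.
move=> fB.
pose g : {additive Y -> int} :=
  HB.pack f (GRing.isZmodMorphism.Build Y int f fB).
exact: (pair_perfectl g).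
Qed.

(** Uniqueness in the perfect pairing, applied to the functional [pair x']. Many identities in [X]
    below are checked by testing against all cocharacters. *)
Lemma pair_injl (x x' : X) : pair x =1 pair x' -> x = x'.
Proof.
move=> xx'.
have [z [zE zU]] := @pair_of_additive (pair x') (pairBr x').
by rewrite -(zU x xx') (zU x').
Qed.

Lemma pair_injr (y y' : Y) : (forall x : X, pair x y = pair x y') -> y = y'.
Proof.
move=> yy'.
have fB : {morph (fun x : X => pair x y') : x x' / x - x'}.
  by move=> x x'; exact: pairBl.
pose g : {additive X -> int} := HB.pack (fun x : X => pair x y')
  (GRing.isZmodMorphism.Build X int (fun x : X => pair x y') fB).
have [z [zE zU]] := pair_perfectr g.
by rewrite -(zU y) ?(zU y').
Qed.

(** The list of roots is finite, while [X] is torsion-free because the pairing separates its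
    elements; a nonzero [d] would give infinitely many roots. *)
Lemma root_line (x d : X) : (forall n : nat, x + d *+ n \in R) -> d = 0.
Proof.
move=> xdR; apply: contrapT => d0.
suff inj : injective (fun n : nat => x + d *+ n).
  have := @uniq_leq_size _ [seq x + d *+ n | n <- iota 0 (size R).+1] R.
  rewrite map_inj_uniq // iota_uniq size_map size_iota ltnn.
  by move=> H; suff: false by []; apply: H => // z /mapP[n _ ->].
move=> m n /addrI mn; apply: contrapT => /eqP nm; apply: d0.
apply: pair_injl => y; rewrite pair0l.
have := congr1 (pairl y) mn; rewrite /= !pairMnl => /eqP.
rewrite -subr_eq0 -mulrBr mulf_eq0 subr_eq0 => /orP[/eqP//|].
by rewrite eqz_nat (negbTE nm).
Qed.

Lemma rootN a : a \in R -> - a \in R.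
Proof.
move=> aR; have := refl_roots aR aR.
by rewrite (pair_coroot aR) mulrzDr mulr1z opprD addrA subrr add0r.
Qed.

Lemma rootNE a : (- a \in R) = (a \in R).
Proof. by apply/idP/idP => /rootN //; rewrite opprK. Qed.

Lemma root_neq0 a : a \in R -> a != 0.
Proof.
move=> aR; apply/eqP => a0; have := pair_coroot aR.
by rewrite a0 pair0l.
Qed.

(* With [c = s_a b] and [e] the root whose coroot is [s_a (coroot b)], the
   maps [s_c s_a s_b s_a] and [s_e s_c] are unipotent on the roots, hence
   trivial there; this forces [e = c]. *)
Lemma coroot_refl a b : a \in R -> b \in R ->
  coroot (refl a b) = corefl a (coroot b).
Proof.
move=> aR bR.
have cR : refl a b \in R := refl_roots aR bR.
have /mapP[e eR eE] := refl_coroots aR bR.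
rewrite -/(corefl a (coroot b)) in eE; rewrite eE.
move cE: (refl a b) cR => c cR.
have pc (x : X) : pair x (coroot e) = pair (refl a x) (coroot b).
  rewrite -eE /refl /corefl pairBl pairBr pairMzl pairMzr; ring.
(* This map is [s_a s_b s_a], a reflection along [c] with [coroot e] in the place of [coroot c]. *)
have rR x : x \in R -> x - c *~ pair x (coroot e) \in R.
  move=> xR; have := refl_roots aR (refl_roots bR (refl_roots aR xR)).
  congr (_ \in R); apply: pair_injl => y.
  rewrite pc -cE /refl !(pairBl, pairMzl, pairDl, pairNl) (pair_coroot aR); ring.
have f0 x : x \in R -> pair x (coroot c) = pair x (coroot e).
  move=> xR; apply/eqP; rewrite -subr_eq0; apply/eqP.
  set phi := _ - _.
  have cce : pair c (coroot e) = 2 by rewrite pc -cE reflK // pair_coroot.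
  have ccc := pair_coroot cR.
  have st (z : X) : z \in R ->
      z + c *~ (pair z (coroot c) - pair z (coroot e)) \in R.
    move=> zR; have := rR _ (refl_roots cR zR).
    rewrite pairBl pairMzl cce -addrA -opprD -mulrzDr -mulrNz.
    by congr (_ + c *~ _ \in R); ring.
  suff : c *~ phi = 0.
    move=> /(congr1 (pairl (coroot c))); rewrite /= pairMzl pair0l ccc.
    by move/eqP; rewrite mulf_eq0 /= => /eqP.
  (* The step [c *~ phi] is the same at each iteration, as [c] pairs to 2 with both coroots. *)
  apply: (@root_line x) => n; elim: n => [|n IH]; first by rewrite addr0.
  have := st _ IH; congr (_ \in R); apply: pair_injl => y.
  rewrite !pairlE ccc cce intS /phi; ring.
have ec2 : pair e (coroot c) = 2 by rewrite f0 // pair_coroot.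
have ce2 : pair c (coroot e) = 2 by rewrite -f0 // pair_coroot.
have [ccc eee] := (pair_coroot cR, pair_coroot eR).
suff /eqP : e - c = 0 by rewrite subr_eq0 => /eqP->.
suff /eqP : (e - c) *+ 2 = 0.
  rewrite -subr_eq0 subr0 => /eqP ec0; apply: pair_injl => y.
  have := congr1 (pairl y) ec0; rewrite /= pairMnl pair0l.
  by move/eqP; rewrite mulf_eq0 orbF => /eqP.
(* All pairings between [c], [e] and their coroots are 2, so [s_e s_c] adds [2 (e - c)] to each
   point of this line. *)
apply: (@root_line c) => n; elim: n => [|n IH]; first by rewrite addr0.
have := refl_roots eR (refl_roots cR IH).
congr (_ \in R); apply: pair_injl => y.
rewrite !pairlE ccc eee ec2 ce2 intS; ring.
Qed.

End Pairing.

(** * The Weyl group acting on roots and coroots *)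

Section WeylAction.
Variable D : based_root_datum.
Local Notation X := (chars D).
Local Notation Y := (cochars D).
Local Notation R := (Defs.roots D).
Implicit Types (a b c : X) (y z : Y) (w u : weyl D).

Lemma wX_root w a : a \in R -> wX w a \in R.
Proof.
case: w => f g /= fg aR; elim: fg => //= b f1 g1 bR _ IH.
exact: refl_roots.
Qed.

Lemma pair_weyl w (x : X) y : pair (wX w x) (wY w y) = pair x y.
Proof.
case: w => f g /=; elim=> //= b f1 g1 bR _ <-.
by rewrite /refl /corefl !(pairlE, pairrE) (pair_coroot bR); ring.
Qed.

Lemma coroot_weyl w a : a \in R -> coroot (wX w a) = wY w (coroot a).
Proof.
case: w => f g /= fg aR; suff : f a \in R /\ coroot (f a) = g (coroot a) by case.
elim: fg => //= b f1 g1 bR _ [fR <-].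
by split; [exact: refl_roots|exact: coroot_refl].
Qed.

Lemma wXM u w (x : X) : wX (u * w)%g x = wX u (wX w x).
Proof. by []. Qed.

Lemma wX1 (x : X) : wX (1%g : weyl D) x = x.
Proof. by []. Qed.

Lemma wXK w : cancel (wX w) (wX w^-1%g).
Proof. by move=> x; rewrite -wXM mulVg. Qed.

Lemma wXKV w : cancel (wX w^-1%g) (wX w).
Proof. by move=> x; rewrite -wXM mulgV. Qed.

Lemma wYKV w : cancel (wY w^-1%g) (wY w).
Proof. by move=> y; rewrite -wYM mulgV. Qed.

Lemma pair_weylVl w (x : X) y : pair (wX w^-1%g x) y = pair x (wY w y).
Proof. by rewrite -[in RHS](wXKV w x) pair_weyl. Qed.

Lemma pair_weylVr w (x : X) y : pair x (wY w^-1%g y) = pair (wX w x) y.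
Proof. by rewrite -{2}(wYKV w y) pair_weyl. Qed.

Lemma wXD w : {morph wX w : x x' / x + x'}.
Proof.
by move=> x x'; apply: pair_injl => y; rewrite -!pair_weylVr !pairDl -!pair_weylVr.
Qed.

Lemma wXN w : {morph wX w : x / - x}.
Proof.
by move=> x; apply: pair_injl => y; rewrite pairNl -!pair_weylVr pairNl.
Qed.

Lemma refl_weyl w a (x : X) : a \in R ->
  wX w (refl a x) = refl (wX w a) (wX w x).
Proof.
move=> aR; apply: pair_injl => y; rewrite -pair_weylVr /refl !pairlE.
by rewrite coroot_weyl // pair_weyl !pair_weylVr.
Qed.

Lemma corefl_weyl w a y : a \in R ->
  wY w (corefl a y) = corefl (wX w a) (wY w y).
Proof.
move=> aR; apply: pair_injr => x; rewrite -pair_weylVl /corefl !pairrE.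
by rewrite coroot_weyl // pair_weyl !pair_weylVl.
Qed.

Lemma weyl_refl_conj w a (aR : a \in R) :
  (w * weyl_refl aR = weyl_refl (wX_root w aR) * w)%g.
Proof.
apply: weyl_eq; apply/funext => x /=; first exact: refl_weyl.
exact: corefl_weyl.
Qed.

Lemma corootN a : a \in R -> coroot (- a) = - coroot a.
Proof.
move=> aR; have := coroot_refl aR aR.
rewrite /refl /corefl (pair_coroot aR) !mulrzDr !mulr1z.
by rewrite !opprD !addrA !subrr !add0r.
Qed.

Lemma weyl_reflE a b (aR : a \in R) (bR : b \in R) :
  b = a \/ b = - a -> weyl_refl bR = weyl_refl aR.
Proof.
move=> bE; apply: weyl_eq; apply/funext => x /=; case: bE => ->//.
  rewrite /refl corootN //; apply: pair_injl => y; rewrite !pairlE !pairrE; ring.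
rewrite /corefl corootN //; apply: pair_injr => y; rewrite !pairrE !pairlE; ring.
Qed.

Lemma weyl_refl2 a (aR : a \in R) : (weyl_refl aR * weyl_refl aR = 1)%g.
Proof.
by apply: weyl_eq; apply/funext => x /=; [exact: reflK|exact: coreflK].
Qed.

Lemma weyl_reflV a (aR : a \in R) : (weyl_refl aR)^-1%g = weyl_refl aR.
Proof. by apply: (mulgI (weyl_refl aR)); rewrite mulgV weyl_refl2. Qed.

Lemma perm_weyl_roots w : perm_eq [seq wX w a | a <- R] R.
Proof.
have inj : injective (wX w) := can_inj (wXK w).
apply: uniq_perm; rewrite ?map_inj_uniq ?roots_uniq // => a.
apply/mapP/idP => [[b bR ->]|aR]; first exact: wX_root.
by exists (wX w^-1%g a); rewrite ?wXKV ?wX_root.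
Qed.

End WeylAction.

(** * Positive roots and a strictly dominant cocharacter *)

Lemma common_denominator (I : finType) (f : I -> rat) :
  exists (d : int) (g : I -> int), 0 < d /\ forall i, f i * d%:~R = (g i)%:~R.
Proof.
exists (\prod_i denq (f i)).
exists (fun i => numq (f i) * \prod_(j | j != i) denq (f j)); split.
  by apply: prodr_gt0 => i _; exact: denq_gt0.
move=> i; rewrite (bigD1 i) //= !rmorphM /= mulrA; congr (_ * _).
by rewrite -{1}[f i]divq_num_den divfK // intr_eq0 denq_neq0.
Qed.

Section Positivity.
Variable D : based_root_datum.
Local Notation X := (chars D).
Local Notation Y := (cochars D).
Local Notation R := (Defs.roots D).
Implicit Types (a b c : X) (y z : Y) (w u : weyl D).

(* The matrix of pairings of the simple roots with a basis of the cocharacters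
   has independent rows, so it has a rational right inverse. *)
Lemma exists_regular_dominant :
  exists y : Y, forall i : 'I_(nsimple D), 0 < pair (simple i) y.
Proof.
have [m [e eP]] := cochars_free D.
pose P : 'M[rat]_(nsimple D, m) := \matrix_(i, j) (pair (simple i) (e j))%:~R.
have /row_freeP[B PB] : row_free P.
  apply: inj_row_free => v vP.
  have [d [g [d0 gE]]] := common_denominator (fun i => v 0 i).
  suff g0 : \sum_i simple i *~ g i = 0.
    apply/rowP => i; rewrite mxE; apply/eqP.
    have := gE i; rewrite (simple_free g0) => /eqP.
    by rewrite mulf_eq0 intr_eq0 (gt_eqF d0) orbF.
  apply: pair_injl => y; rewrite pair0l.
  have [c [-> _]] := eP y; rewrite pair_sumr big1 // => j _.
  rewrite pairMzr; apply/eqP; rewrite mulf_eq0; apply/orP; left.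
  rewrite pair_suml -(intr_eq0 rat) rmorph_sum /=.
  have := congr1 (fun M : 'rV_m => M 0 j * d%:~R) vP; rewrite !mxE mul0r mulr_suml.
  move=> s0; apply/eqP; rewrite -[RHS]s0; apply: eq_bigr => i _.
  by rewrite pairMzl rmorphM /= -gE mxE; ring.
have [d [g [d0 gE]]] := common_denominator (fun j => (B *m const_mx 1 : 'cV_m) j 0).
exists (\sum_j e j *~ g j) => i; rewrite pair_sumr -(ltr_int rat) rmorph_sum /=.
suff -> : \sum_j (pair (simple i) (e j *~ g j))%:~R = d%:~R :> rat.
  by rewrite ltr_int.
have := congr1 (fun M : 'cV_(nsimple D) => M i 0 * d%:~R)
  (mulmxA P B (const_mx 1 : 'cV_(nsimple D))).
rewrite PB mul1mx !mxE mul1r mulr_suml => <-; apply: eq_bigr => j _.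
by rewrite pairMzr rmorphM /= -gE mulrA; congr (_ * _ * _); rewrite mxE.
Qed.

(** This is the [rho] of the overview; its pairing decides the sign of every root, see
    [positiveE]. *)
Definition rdom : Y := sval (cid exists_regular_dominant).

Lemma rdom_simple i : 0 < pair (simple i) rdom.
Proof. exact: svalP (cid exists_regular_dominant) i. Qed.

Lemma nonneg_combP (x : X) :
  reflect (exists c : 'I_(nsimple D) -> nat, x = \sum_i simple i *+ c i)
    (nonneg_comb x).
Proof. exact: asboolP. Qed.

Lemma nonneg_comb_ge0 (x : X) : nonneg_comb x -> 0 <= pair x rdom.
Proof.
move=> /nonneg_combP[c ->]; rewrite pair_suml sumr_ge0 // => i _.
by rewrite pairMnl mulr_ge0 // ltW // rdom_simple.
Qed.

Lemma nonneg_comb_eq0 (x : X) : nonneg_comb x -> (pair x rdom == 0) = (x == 0).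
Proof.
move=> /nonneg_combP[c ->]; apply/eqP/eqP => [s0|->]; last exact: pair0l.
have := s0; rewrite pair_suml => /eqP.
rewrite psumr_eq0 => [/allP c0|i _]; last first.
  by rewrite pairMnl mulr_ge0 // ltW // rdom_simple.
apply: big1 => i _; have := c0 i; rewrite mem_index_enum => /(_ isT) /=.
by rewrite pairMnl mulf_eq0 gt_eqF ?rdom_simple //= eqz_nat => /eqP->.
Qed.

Lemma nonneg_comb_gt0 (x : X) : nonneg_comb x -> x != 0 -> 0 < pair x rdom.
Proof. by move=> xp x0; rewrite lt0r nonneg_comb_eq0 // x0 nonneg_comb_ge0. Qed.

Lemma nonneg_comb_root a : a \in R -> nonneg_comb a \/ nonneg_comb (- a).
Proof.
move=> aR; have [c [aE|aE]] := simple_gen aR; [left|right].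
  by apply/nonneg_combP; exists c.
by apply/nonneg_combP; exists c; rewrite aE opprK.
Qed.

Lemma positiveE a : positive a = (a \in R) && (0 < pair a rdom).
Proof.
rewrite /positive; case aR: (a \in R) => //=.
apply/idP/idP => [ap|agt]; first by rewrite nonneg_comb_gt0 ?root_neq0.
have [//|/nonneg_comb_ge0] := nonneg_comb_root aR.
by rewrite pairNl oppr_ge0 leNgt agt.
Qed.

Lemma negativeE a : negative a = (a \in R) && (pair a rdom < 0).
Proof. by rewrite /negative positiveE rootNE pairNl oppr_gt0. Qed.

Lemma rdom_root a : a \in R -> pair a rdom != 0.
Proof.
move=> aR; have [ap|ap] := nonneg_comb_root aR.
  by rewrite nonneg_comb_eq0 // root_neq0.
by rewrite -oppr_eq0 -pairNl nonneg_comb_eq0 // oppr_eq0 root_neq0.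
Qed.

Lemma root_sign a : a \in R -> negative a = ~~ positive a.
Proof.
move=> aR; rewrite positiveE negativeE aR /=.
by have := rdom_root aR; case: ltgtP.
Qed.

Lemma negativeN a : negative (- a) = positive a.
Proof. by rewrite /negative opprK. Qed.

Lemma simple_positive i : positive (simple i : X).
Proof. by rewrite positiveE simple_root rdom_simple. Qed.

Hypothesis D_reduced : reduced D.

(** The reflection changes only the coefficient at [i]. If another coefficient of [a] is positive,
    it forces the image to be positive; otherwise [a] is a multiple of [simple i], and reducedness
    applies. *)
Lemma refl_simple_positive (i : 'I_(nsimple D)) a :
  positive a -> a != simple i -> positive (refl (simple i) a).
Proof.
move=> ap ai; have /andP[aR /nonneg_combP[c cE]] := ap.
have sR := refl_roots (simple_root i) aR.
case: (pselect (exists2 j, j != i & c j != 0%N)) => [[j ji cj]|nj].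
  rewrite -[positive _]negbK -root_sign //.
  apply/negP => /andP[_ /nonneg_combP[d dE]].
  (* If [c] are the coefficients of [a] and [d] those of the negative of its image, independence
     gives [c j + d j = 0]. *)
  have /simple_free/(_ j) : \sum_k simple k *~ ((c k + d k)%:Z -
     (if k == i then pair a (coroot (simple i)) else 0)) = 0.
    set n := pair a _.
    transitivity (\sum_k (simple k *+ c k + simple k *+ d k -
        (if k == i then simple i *~ n else 0))).
      apply: eq_bigr => k _; rewrite mulrzBr -pmulrn mulrnDr; congr (_ - _).
      by case: eqP => [->//|_]; rewrite mulr0z.
    rewrite sumrB big_split /= -cE -dE -big_mkcond big_pred1_eq addrAC.
    exact: subrr.
  by rewrite (negbTE ji) subr0 => /eqP; rewrite eqz_nat addn_eq0 (negbTE cj).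
have aE : a = simple i *+ c i.
  rewrite cE (bigD1 i) //= big1 ?addr0 // => j ji.
  case: (c j =P 0%N) => [->//|/eqP cj].
  by case: nj; exists j.
have [] := @D_reduced (simple i) a (c i)%:Z 1 (simple_root i) aR.
- apply: contra_not_neq (negP (root_neq0 aR)) => c0.
  by apply/eqP; rewrite aE pmulrn c0.
- by rewrite mulr1z -pmulrn aE.
- by move/eqP; rewrite (negbTE ai).
- move=> aN; have := simple_positive i; rewrite -negativeN -aN root_sign //.
  by rewrite ap.
Qed.

End Positivity.

(** * Length and hyperplanes *)

Section Separation.
Variable D : based_root_datum.
Local Notation X := (chars D).
Local Notation Y := (cochars D).
Local Notation R := (Defs.roots D).
Implicit Types (a b c : X) (y z : Y) (w u : weyl D) (x : aff_weyl D).

(* The signed number of hyperplanes of direction [a] separating the base alcove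
   from its image under [x]: if [p] is in the base alcove, it is
   [floor (a (x p)) - floor (a p)]. *)
Definition sep x a : int :=
  pair a (atrans x) - (negative (wX (alin x)^-1%g a) : nat)%:Z +
  (negative a : nat)%:Z.

(** Cocycle identity: a gallery to [x x'] is one to [x] followed by the image under [x] of one to
    [x']. *)
Lemma sepM x x' a : sep (x * x')%g a = sep x a + sep x' (wX (alin x)^-1%g a).
Proof.
by rewrite /sep /= invgM wXM pairDr pair_weylVl; ring.
Qed.

Lemma sepN x a : a \in R -> sep x (- a) = - sep x a.
Proof.
move=> aR; rewrite /sep wXN pairNl !negativeN -[positive a]negbK -root_sign //.
rewrite -[positive _]negbK -root_sign ?wX_root //.
by case: negative; case: negative => /=; ring.
Qed.

Lemma sep1 a : sep 1%g a = 0.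
Proof. by rewrite /sep /= invg1 wX1 pair0r sub0r addNr. Qed.

Lemma sepV x a : sep x^-1%g a = - sep x (wX (alin x) a).
Proof.
have := sepM x x^-1%g (wX (alin x) a); rewrite mulgV sep1 wXK => /eqP.
by rewrite eq_sym addrC addr_eq0 => /eqP.
Qed.

Lemma sum_roots_weyl w (F : X -> nat) :
  (\sum_(a <- R) F (wX w a) = \sum_(a <- R) F a)%N.
Proof. by rewrite -[RHS](perm_big _ (perm_weyl_roots w)) big_map. Qed.

Lemma perm_oppr_roots : perm_eq [seq - a | a <- R] R.
Proof.
apply: uniq_perm; rewrite ?(map_inj_uniq oppr_inj) ?roots_uniq // => a.
apply/mapP/idP => [[b bR ->]|aR]; first exact: rootN.
by exists (- a); rewrite ?opprK ?rootN.
Qed.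

(** The length formula, reindexed by [w], sums [absz (sep x (w a))] over the positive [a]. As
    [sep x] is odd, the negative roots contribute the same amount, hence the doubling. *)
Lemma length_sep x : ((aff_length x).*2 = \sum_(a <- R) absz (sep x a))%N.
Proof.
have -> : aff_length x =
    (\sum_(a <- R | positive a) absz (sep x (wX (alin x) a)))%N.
  rewrite /aff_length [RHS](bigID (fun a => negative (wX (alin x) a))) /=.
  congr addn; last first.
    rewrite big_seq_cond [RHS]big_seq_cond.
    apply: eq_big => [a|a /and3P[aR ap wap]].
      by case aR: (a \in R) => //=; rewrite root_sign ?wX_root // negbK.
    rewrite /sep wXK pair_weylVr !root_sign ?wX_root // ap wap /=.
    by rewrite subr0 addr0.
  rewrite big_seq_cond [RHS]big_seq_cond; apply: eq_bigr => a /and3P[aR ap wan].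
  by rewrite /sep wXK pair_weylVr [negative a]root_sign // ap wan /= subr0.
rewrite -(sum_roots_weyl (alin x)) [RHS](bigID (@positive D)) /= -addnn.
congr addn.
rewrite -[in RHS](perm_big _ perm_oppr_roots) big_map.
rewrite big_seq_cond [RHS]big_seq_cond; apply: eq_big => a.
  by case aR: (a \in R); rewrite //= -root_sign ?rootN // negativeN.
by move=> /andP[aR _]; rewrite wXN sepN ?abszN // wX_root.
Qed.

(** If the two summands of [sepM] never have opposite signs, no hyperplane is crossed back and the
    absolute values add. *)
Lemma lengthM x x' :
  {in R, forall a, 0 <= sep x a * sep x' (wX (alin x)^-1%g a)} ->
  aff_length (x * x')%g = (aff_length x + aff_length x')%N.
Proof.
move=> ge0; apply: double_inj; rewrite doubleD !length_sep.
rewrite -[in X in (_ + X)%N](sum_roots_weyl (alin x)^-1%g) -big_split /=.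
rewrite big_seq [RHS]big_seq; apply: eq_bigr => a aR; rewrite sepM.
by have := ge0 a aR; nia.
Qed.

Lemma length_eq0 x : aff_length x = 0%N <-> {in R, forall a, sep x a = 0}.
Proof.
split=> [x0 a aR|x0]; last first.
  by apply: double_inj; rewrite length_sep big_seq big1 // => a /x0->.
have := length_sep x; rewrite x0 => /esym/eqP.
by rewrite sum_nat_seq_eq0 => /allP/(_ a aR) /=; rewrite absz_eq0 => /eqP.
Qed.

Variable a0 : highest_root D.

Lemma hroot_le b : b \in R ->
  pair b (rdom D) <= pair a0 (rdom D) ?= iff (b == hroot a0).
Proof.
move=> bR; have := nonneg_comb_ge0 (hroot_max a0 bR).
have := nonneg_comb_eq0 (hroot_max a0 bR).
rewrite pairBl subr_ge0 !subr_eq0 => ba ge; split=> //.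
by rewrite eq_sym ba eq_sym.
Qed.

Lemma hroot_positive : positive a0.
Proof.
have a0R := hroot_root a0; rewrite positiveE a0R /=.
have := (hroot_le (rootN a0R)).1; rewrite pairNl => le.
by have := rdom_root a0R; lia.
Qed.

(** Were the pairing at least 2, the root [- s_(a0) b] would have a larger value at [rdom] than the
    highest root. *)
Lemma pair_hroot b : b \in R -> b != hroot a0 -> pair b (coroot a0) <= 1.
Proof.
move=> bR ba; have a0R := hroot_root a0.
have /hroot_le[le _] := rootN (refl_roots a0R bR).
have lt : pair b (rdom D) < pair a0 (rdom D).
  by rewrite lt_neqAle (hroot_le bR).1 (hroot_le bR).2 ba.
have := hroot_positive; rewrite positiveE a0R /= => gt0.
move: gt0 le lt; rewrite pairNl pairBl pairMzl.
move: (pair b (coroot a0)) (pair b _) (pair (hroot a0) _) => n B A; nia.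
Qed.

Definition aroot (j : 'I_(nsimple D).+1) : X :=
  if unlift ord0 j is Some i then simple i else a0.

Definition ashift (j : 'I_(nsimple D).+1) : bool :=
  if unlift ord0 j is Some i then false else true.

(* The gradient of the affine simple root of index [j]; the affine root is
   [agrad j + ashift j] and is positive on the base alcove. *)
Definition agrad (j : 'I_(nsimple D).+1) : X :=
  if ashift j then - aroot j else aroot j.

Lemma aroot_root j : aroot j \in R.
Proof.
by rewrite /aroot; case: unlift => [i|]; [exact: simple_root|exact: hroot_root].
Qed.

Lemma agrad_root j : agrad j \in R.
Proof. by rewrite /agrad; case: ashift; rewrite ?rootNE aroot_root. Qed.

Lemma aff_reflE j :
  aff_refl a0 j = AffWeyl (coroot (aroot j) *+ ashift j) (weyl_refl (aroot_root j)).
Proof.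
move: (aroot_root j); rewrite /aff_refl /aroot /ashift.
case: unlift => [i|] aR; rewrite ?mulr0n ?mulr1n.
  by rewrite /lin (bool_irrelevance aR (simple_root i)).
rewrite /transl /lin (bool_irrelevance aR (hroot_root a0)).
by rewrite -[LHS]/(aff_mul _ _) /aff_mul /= addr0 mul1g.
Qed.

Lemma aff_refl2 j : (aff_refl a0 j * aff_refl a0 j = 1)%g.
Proof.
rewrite aff_reflE -[LHS]/(aff_mul _ _) /aff_mul /= weyl_refl2; congr AffWeyl.
apply: pair_injr => x; rewrite pair0r /corefl !pairrE.
by rewrite (pair_coroot (aroot_root j)); ring.
Qed.

Lemma alin_aff_reflV j : (alin (aff_refl a0 j))^-1%g = alin (aff_refl a0 j).
Proof. by rewrite aff_reflE /= weyl_reflV. Qed.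

Lemma refl_agrad j : wX (alin (aff_refl a0 j)) (agrad j) = - agrad j.
Proof.
have H : refl (aroot j) (aroot j) = - aroot j.
  rewrite /refl (pair_coroot (aroot_root j)).
  by apply: pair_injl => y; rewrite !pairlE; ring.
rewrite aff_reflE /= /agrad; case: ifP => // _.
by rewrite -[LHS]/(wX (weyl_refl (aroot_root j)) _) wXN /= H.
Qed.

Hypothesis D_reduced : reduced D.

(** Only the wall of type [j] separates the base alcove from its image under [s_j]. For a simple
    reflection this is the permutation of the other positive roots; for [s_0] it rests on
    [pair_hroot]. *)
Lemma sep_refl j a : a \in R ->
  sep (aff_refl a0 j) a = ((a == - agrad j) : nat)%:Z - ((a == agrad j) : nat)%:Z.
Proof.
have key b : b \in R -> 0 <= pair b (coroot (aroot j)) *+ ashift j ->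
    b != agrad j -> b != - agrad j -> sep (aff_refl a0 j) b = 0.
  move=> bR; rewrite aff_reflE /sep /= weyl_reflV /agrad /aroot /ashift /=.
  case: unlift => [i|] ge0 bj bNj; rewrite ?mulr0n ?mulr1n ?pair0r.
    rewrite add0r !root_sign ?refl_roots ?simple_root //.
    case: (boolP (positive b)) => [bp|]; first by rewrite refl_simple_positive.
    rewrite -root_sign // => bn; have bNp : positive (- b) := bn.
    have := refl_simple_positive (i := i) D_reduced bNp.
    rewrite eqr_oppLR => /(_ bNj).
    rewrite -[refl _ _]/(wX (simple_refl i) _) wXN -/(negative _) root_sign.
      by move/negbTE->.
    exact: wX_root.
  rewrite opprK in bNj; have := pair_hroot bR bNj; rewrite mulr1n in ge0.
  case: (pair b (coroot a0) =P 0) => [b0 _|bn0 le1].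
    by rewrite /refl b0 mulr0z subr0 sub0r addNr.
  (* Here [s_(a0) b = b - a0] is negative and [b] is not, so the sign term cancels the translation
     term 1. *)
  have b1 : pair b (coroot a0) = 1 by lia.
  have a0R := hroot_root a0.
  have le := (hroot_le (rootN (refl_roots a0R bR))).1.
  have lt : pair b (rdom D) < pair a0 (rdom D).
    by rewrite lt_neqAle (hroot_le bR).1 (hroot_le bR).2 bNj.
  rewrite b1 !negativeE refl_roots // bR /= /refl pairBl pairMzl b1.
  rewrite mulr1 subr_lt0 lt /=; rewrite pairNl pairBl pairMzl b1 in le.
  by rewrite ltNge (_ : 0 <= _) //; lia.
move=> aR; have gR := agrad_root j.
have sg : sep (aff_refl a0 j) (agrad j) = -1.
  rewrite /sep alin_aff_reflV refl_agrad negativeN aff_reflE /=.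
  rewrite /agrad /aroot /ashift; case: unlift => [i|] /=.
    rewrite mulr0n pair0r simple_positive root_sign ?simple_root //.
    by rewrite simple_positive.
  rewrite mulr1n pairNl (pair_coroot (hroot_root a0)) negativeN hroot_positive.
  rewrite -[positive _]negbK -root_sign ?rootN ?hroot_root // negativeN.
  by rewrite hroot_positive.
have gN : agrad j != - agrad j.
  apply/eqP => /(congr1 (fun b => pair b (rdom D))); rewrite pairNl.
  by have := rdom_root gR; lia.
case: (a =P agrad j) => [->|/eqP ag]; first by rewrite (negbTE gN) sg.
case: (a =P - agrad j) => [->|/eqP aNg]; first by rewrite sepN // sg.
(* Roots with a negative pairing are reduced to [key] by the oddness of [sep]. *)
case: (leP 0 (pair a (coroot (aroot j)) *+ ashift j)) => [ge0|lt0].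
  exact: key.
rewrite subr0 -[a]opprK sepN ?rootN // key ?oppr0 ?rootN //.
- by rewrite pairNl mulNrn oppr_ge0 ltW.
- by rewrite eqr_oppLR.
- by rewrite eqr_opp.
Qed.

End Separation.

(** * Generation by affine simple reflections and elements of length 0 *)

Section Generation.
Variable D : based_root_datum.
Local Notation X := (chars D).
Local Notation Y := (cochars D).
Local Notation R := (Defs.roots D).
Implicit Types (a b c : X) (y z : Y) (w u : weyl D) (x : aff_weyl D).

Lemma nonneg_comb_pair (a : X) (z : Y) : (forall i, 0 <= pair (simple i) z) ->
  nonneg_comb a -> 0 <= pair a z.
Proof.
move=> z0 /nonneg_combP[c ->]; rewrite pair_suml sumr_ge0 // => i _.
by rewrite pairMnl mulr_ge0.
Qed.

Variable a0 : highest_root D.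

Lemma agrad_lift i : agrad a0 (lift ord0 i) = simple i.
Proof. by rewrite /agrad /ashift /aroot liftK. Qed.

Lemma agrad0 : agrad a0 ord0 = - (a0 : X).
Proof. by rewrite /agrad /ashift /aroot unlift_none. Qed.

(* The point [(y + w (rdom / N))] of the alcove of [x = epsilon^y w] lies in
   the base alcove. *)
Lemma dominant_length0 x :
  (forall j, 0 <= sep x (agrad a0 j)) -> aff_length x = 0%N.
Proof.
move=> ge0; apply/length_eq0.
pose N := pair a0 (rdom D) + 1.
pose z := atrans x *~ N + wY (alin x) (rdom D).
(* As [N] exceeds the value of every root at [rdom], [sep x a] is the integer part of [a] at the
   point [z / N]. *)
have key a : positive a -> 0 < pair a z - N * sep x a < N.
  move=> /[dup] ap /andP[aR _]; pose b := wX (alin x)^-1%g a.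
  have bR : b \in R by apply: wX_root.
  have -> : pair a z - N * sep x a = pair b (rdom D) + N * (negative b : nat)%:Z.
    rewrite /sep [negative a]root_sign // ap /= /z !pairrE -pair_weylVl -/b; ring.
  have := (hroot_le a0 bR).1; have := (hroot_le a0 (rootN bR)).1.
  rewrite pairNl negativeE bR /= /N; have := rdom_root bR.
  by case: ltP => /=; lia.
have N0 : 0 < N by have := hroot_positive a0; rewrite positiveE /N => /andP[_]; lia.
have zs i : 0 <= pair (simple i) z.
  have := ge0 (lift ord0 i); rewrite agrad_lift; have := key _ (simple_positive i).
  by move: (sep x _) (pair _ z) N0 => s t; nia.
have := ge0 ord0; rewrite agrad0 sepN ?hroot_root // => le0.
(* On the dominant [z], the value of [a] lies between 0 and that of the highest root, which is below
   [N]. *)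
have pos a : positive a -> sep x a = 0.
  move=> /[dup] ap /andP[aR ac].
  have := nonneg_comb_pair zs (hroot_max a0 aR); have := nonneg_comb_pair zs ac.
  rewrite pairBl; have := key _ (hroot_positive a0); have := key _ ap.
  move: le0 N0; move: (sep x a) (sep x (hroot a0)) (pair a z) (pair (hroot a0) z).
  by clearbody z N => s s0 t t0; nia.
move=> a aR; case: (boolP (positive a)) => [/pos//|]; rewrite -root_sign // => an.
by apply: oppr_inj; rewrite -sepN // oppr0 pos.
Qed.

Hypothesis D_reduced : reduced D.

Lemma sep_refl_neq0 j a : a \in R -> sep (aff_refl a0 j) a != 0 ->
  a = agrad a0 j \/ a = - agrad a0 j.
Proof.
move=> aR; rewrite (sep_refl a0 D_reduced) //.
case: (a =P - _) => [|_]; first by right.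
by case: (a =P _); [left|].
Qed.

Lemma sep_refl_agrad j : sep (aff_refl a0 j) (agrad a0 j) = - 1.
Proof.
rewrite (sep_refl a0 D_reduced) ?agrad_root // eqxx.
suff -> : agrad a0 j == - agrad a0 j = false by [].
apply/eqP => /(congr1 (fun b => pair b (rdom D))); rewrite pairNl.
by have := rdom_root (agrad_root a0 j); lia.
Qed.

(** The wall of type [j] separates the base alcove from that of [x], so lengths add in
    [x = s_j (s_j x)]; only the directions of this wall need a sign check. *)
Lemma length_refl_lt x j : sep x (agrad a0 j) < 0 ->
  (aff_length (aff_refl a0 j * x)%g < aff_length x)%N.
Proof.
set s := aff_refl a0 j => lt0; have gR := agrad_root a0 j.
have xE : x = (s * (s * x))%g by rewrite mulgA aff_refl2 mul1g.
have sE a : sep (s * x)%g (wX (alin s)^-1%g a) = sep x a - sep s a.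
  by rewrite [in RHS]xE [in RHS](sepM s); ring.
have -> : aff_length x = (aff_length s + aff_length (s * x)%g)%N.
  rewrite {1}xE lengthM // => a aR; rewrite sE.
  case: (sep s a =P 0) => [->|/eqP/(sep_refl_neq0 aR)[]->].
  - by rewrite mul0r.
  - by rewrite sep_refl_agrad; lia.
  - by rewrite !sepN // sep_refl_agrad; lia.
rewrite -[X in (X < _)%N]add0n ltn_add2r lt0n; apply/eqP => /length_eq0/(_ _ gR).
by rewrite sep_refl_agrad.
Qed.

(** Induction on the length: reflect in a separating wall of the base alcove while there is one;
    then [dominant_length0] applies. *)
Lemma aff_weyl_generation x : exists (s : seq 'I_(nsimple D).+1) (o : aff_weyl D),
  omega o /\ x = (\prod_(j <- s) aff_refl a0 j * o)%g.
Proof.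
move: {2}(aff_length x) (leqnn (aff_length x)) => n.
elim: n x => [|n IH] x le.
  exists [::], x; rewrite big_nil mul1g; split=> //.
  by rewrite /omega /=; lia.
case: (pselect (forall j, 0 <= sep x (agrad a0 j))) => [/dominant_length0 x0|].
  by exists [::], x; rewrite big_nil mul1g.
move=> /existsNP[j /negP]; rewrite -ltNge => /length_refl_lt lt.
have [|s [o [oO sE]]] := IH (aff_refl a0 j * x)%g.
  by rewrite -ltnS; exact: leq_trans lt le.
exists (j :: s), o; split=> //.
by rewrite big_cons -mulgA -sE mulgA aff_refl2 mul1g.
Qed.

End Generation.

(** * Alcoves *)

Section Alcoves.
Local Open Scope classical_set_scope.

Lemma continuous_ptws (I : choiceType) (T V : topologicalType)
    (f : T -> {ptws I -> V}) :
  (forall i, continuous (fun t => f t i)) -> continuous f.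
Proof.
move=> fc t; apply/cvg_sup => i U.
have /= -> := @nbhsE (initial_topology (@proj I (fun=> V) i)) (f t).
case=> B [[C oC <-] Cft] sub; apply: (filterS sub).
by apply: (fc i t C); apply: open_nbhs_nbhs.
Qed.

Variables (D : based_root_datum) (a0 : highest_root D) (K : realType).
Local Notation X := (chars D).
Local Notation Y := (cochars D).
Local Notation R := (Defs.roots D).
Local Notation P := {ptws X -> K}.
Local Notation space := (@Defs.space D K).
Implicit Types (a b c : X) (y z : Y) (w u : weyl D) (x : aff_weyl D) (p q : P).

Lemma space0 p : space p -> p 0 = 0.
Proof. by move=> sp; apply: (addrI (p 0)); rewrite -sp !addr0. Qed.

Lemma spaceN p a : space p -> p (- a) = - p a.
Proof. by move=> sp; apply: (addrI (p a)); rewrite -sp !subrr space0. Qed.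

Lemma spaceB p a b : space p -> p (a - b) = p a - p b.
Proof. by move=> sp; rewrite sp spaceN. Qed.

Lemma spaceMn p a n : space p -> p (a *+ n) = p a *+ n.
Proof.
by move=> sp; elim: n => [|n IH]; rewrite ?space0 // !mulrS sp IH.
Qed.

Lemma spaceMz p a n : space p -> p (a *~ n) = p a *~ n.
Proof.
by move=> sp; case: n => n; rewrite ?NegzE ?mulrNz ?spaceN // -!pmulrn spaceMn.
Qed.

Lemma space_comb p (c : 'I_(nsimple D) -> nat) : space p ->
  p (\sum_i simple i *+ c i) = \sum_i p (simple i) *+ c i.
Proof.
move=> sp; elim/big_rec2: _ => [|i u v _ <-]; first exact: space0.
by rewrite sp spaceMn.
Qed.

Lemma space_pair z (k : K) : space ((fun x : X => (pair x z)%:~R * k) : P).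
Proof. by move=> b b'; rewrite pairDl rmorphD mulrDl. Qed.

Definition fund_alcove : set P :=
  [set p | [/\ space p, forall i, 0 < p (simple i) & p a0 < 1]].

Lemma fund_root p a : fund_alcove p -> positive a -> 0 < p a < 1.
Proof.
move=> [sp p0 p1] /andP[aR ac].
have ge0 b : nonneg_comb b -> 0 <= p b.
  move=> /nonneg_combP[c ->]; rewrite space_comb // sumr_ge0 // => i _.
  by rewrite mulrn_wge0 // ltW.
have /ge0 := hroot_max a0 aR; rewrite spaceB // subr_ge0 => le.
rewrite (le_lt_trans le p1) andbT lt0r ge0 // andbT.
have /nonneg_combP[c cE] := ac; rewrite cE space_comb //.
rewrite psumr_eq0 => [|i _]; last by rewrite mulrn_wge0 // ltW.
apply: contra (root_neq0 aR) => /allP z; rewrite cE big1 // => i _.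
have := z i; rewrite mem_index_enum => /(_ isT) /=.
by rewrite mulrn_eq0 (gt_eqF (p0 i)) orbF => /eqP->.
Qed.

Lemma fund_compl : fund_alcove `<=` @hyperplane_compl D K.
Proof.
move=> p fp; have [sp _ _] := fp; split=> // a n aR [_ pan].
have key b m : positive b -> p b <> m%:~R.
  move=> bp pb; have := fund_root fp bp.
  by rewrite pb -[1]/(1%:~R) -[0]/(0%:~R) !ltr_int; lia.
case: (boolP (positive a)) => [ap|]; first exact: (key a n).
  rewrite -root_sign // => an.
by apply: (key _ (- n) an); rewrite spaceN // pan rmorphN.
Qed.

(** The denominator exceeds the value of the highest root at [rdom], which puts the point below
    [H_(a0, 1)]. *)
Definition fund_point : P :=
  fun c => (pair c (rdom D))%:~R * ((pair a0 (rdom D) + 1)%:~R)^-1.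

Lemma fund_pointP : fund_alcove fund_point.
Proof.
have gt0 : 0 < pair a0 (rdom D).
  by have := hroot_positive a0; rewrite positiveE => /andP[].
have gt1 : 0 < (pair a0 (rdom D) + 1)%:~R :> K by rewrite ltr0z; lia.
split; first exact: space_pair.
  by move=> i; rewrite divr_gt0 // ltr0z rdom_simple.
by rewrite ltr_pdivrMr // mul1r ltr_int; lia.
Qed.

(** Evaluation at [a] is continuous, so the component maps onto an interval, and this interval
    misses all integers. *)
Lemma connected_component_side p q a (n : int) : a \in R ->
  connected_component (@hyperplane_compl D K) p q ->
  n%:~R < p a -> n%:~R < q a.
Proof.
move=> aR pq pn; rewrite ltNge; apply/negP => qn.
set B := connected_component _ _ in pq.
have Bp : B p by exact: connected_component_trans pq (connected_component_sym pq).
have cB : connected ((fun r : P => r a) @` B).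
  apply: connected_continuous_connected; first exact: component_connected.
  apply: continuous_subspaceT; exact: (@proj_continuous X (fun=> K) a).
have [r Br rn] : ((fun r : P => r a) @` B) n%:~R.
  move/connected_intervalP : cB => cB; apply: (cB (q a) (p a)).
  - by exists q.
  - by exists p.
  - by rewrite qn ltW.
have [sr /(_ a n aR)] := connected_component_sub Br.
by apply; split.
Qed.

Lemma fund_connected p q : fund_alcove p -> fund_alcove q ->
  connected_component (@hyperplane_compl D K) p q.
Proof.
move=> fp fq; have [[sp p0 p1] [sq q0 q1]] := (fp, fq).
pose f (t : K) : P := fun c => p c + t * (q c - p c).
have fc : continuous f.
  apply: continuous_ptws => i t; apply: cvgD; first exact: cvg_cst.
  by apply: cvgM; [exact: cvg_id|exact: cvg_cst].
have f0 : f 0 = p by apply/funext => x; rewrite /f mul0r addr0.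
have f1 : f 1 = q by apply/funext => x; rewrite /f mul1r addrC subrK.
exists (f @` `[0, 1]); last by exists 1 => //=; rewrite in_itv /= ler01 lexx.
split.
- by exists 0 => //=; rewrite in_itv /= ler01 lexx.
- move=> _ [t /= /[!in_itv] /= /andP[t0 t1] <-]; apply: fund_compl; split.
  + by move=> x x'; rewrite /f sp sq; ring.
  + by move=> i; rewrite /f; have := p0 i; have := q0 i; nra.
  + rewrite /f; move: t0; rewrite le_eqVlt => /orP[/eqP<-|tp]; first by lra.
    have : t * q a0 < t * 1 by rewrite ltr_pM2l.
    have : (1 - t) * p a0 <= (1 - t) * 1 by rewrite ler_wpM2l ?subr_ge0 // ltW.
    by lra.
- apply: connected_continuous_connected; first exact: segment_connected.
  exact: continuous_subspaceT.
Qed.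

Lemma fund_component p : fund_alcove p ->
  connected_component (@hyperplane_compl D K) p = fund_alcove.
Proof.
move=> fp; apply/seteqP; split=> q; last exact: fund_connected.
move=> pq; have [sq _] := connected_component_sub pq; split=> //.
  move=> i; apply: (@connected_component_side p q (simple i) 0) => //.
    exact: simple_root.
  by have [_] := fp.
have sp : space p by have [] := fp.
have := @connected_component_side p q (- (a0 : X)) (- 1) (rootN (hroot_root a0)) pq.
by rewrite !spaceN // rmorphN !ltrN2; apply; have [] := fp.
Qed.

(** Shrinking [fund_point] towards 0 puts the origin in the closure. Conversely, a dominant alcove
    beyond [H_(a0, 1)] stays away from the origin, which gives uniqueness. *)
Lemma base_alcoveE : @base_alcove D K = fund_alcove.
Proof.
apply: xget_unique.
  split; first by exists fund_point; [exact/fund_compl/fund_pointP|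
    rewrite fund_component //; exact: fund_pointP].
    by move=> p [].
  move=> U U0.
  pose f (t : K) : P := fun c => t * fund_point c.
  have fc : continuous f.
    by apply: continuous_ptws => i t; apply: cvgM; [exact: cvg_id|exact: cvg_cst].
  have f0 : f 0 = (fun=> 0) by apply/funext => x; rewrite /f mul0r.
  have : \forall t \near nbhs (0 : K), U (f t) by apply: fc; rewrite f0.
  move=> /nbhs_ballP[e /= e0 eU].
  pose t := Num.min (e / 2) 1.
  have t0 : 0 < t by rewrite lt_min divr_gt0 // ltr01.
  exists (f t); split; last first.
    apply: eU; rewrite /ball /= sub0r normrN gtr0_norm // gt_min.
    by rewrite ltr_pdivrMr // ltr_pMr // ltr1n.
  have [sp p0 p1] := fund_pointP; split.
  - by move=> x x'; rewrite /f sp mulrDr.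
  - by move=> i; rewrite mulr_gt0.
  - apply: le_lt_trans p1; rewrite ler_piMl ?ge_min ?lexx ?orbT //.
    by have /andP[/ltW] := fund_root fund_pointP (hroot_positive a0).
move=> A [[p pc ->] Adom A0]; apply: fund_component.
have pp := connected_component_refl pc.
have [sp p0] := Adom _ pp; split=> //.
rewrite ltNge; apply/negP; rewrite le_eqVlt => /orP[/eqP p1|p1].
  by have [_ /(_ a0 1 (hroot_root a0))] := pc; apply; split.
have : nbhs ((fun=> 0) : P) [set q : P | q a0 < 1].
  apply: (@proj_continuous X (fun=> K) (a0 : X) (fun=> 0) [set r | r < 1]).
  by apply: open_nbhs_nbhs; split; [exact: open_lt|rewrite /=; exact: ltr01].
move=> /A0[q [pq /=]]; rewrite ltNge => /negP; apply.
by apply/ltW/(@connected_component_side p q a0 1) => //; exact: hroot_root.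
Qed.

Lemma aff_actM x x' p : aff_act x (aff_act x' p) = aff_act (x * x')%g p.
Proof.
apply/funext => c; rewrite /aff_act /= invgM wXM pairDr rmorphD /= addrA.
by rewrite pair_weylVl.
Qed.

Lemma aff_act1 p : aff_act 1%g p = p.
Proof. by apply/funext => c; rewrite /aff_act /= invg1 wX1 pair0r add0r. Qed.

Lemma aff_act_space x p : space p -> space (aff_act x p).
Proof.
by move=> sp c c'; rewrite /aff_act wXD sp pairDl rmorphD /=; ring.
Qed.

Lemma base_wallE j :
  base_wall a0 j = hyperplane (agrad a0 j) (- (ashift j : nat)%:Z) :> set P.
Proof.
have E p c : space p -> aff_act (aff_refl a0 j) p c =
    p c + (pair c (coroot (aroot a0 j)))%:~R * ((ashift j)%:R - p (aroot a0 j)).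
  move=> sp; rewrite /aff_act alin_aff_reflV aff_reflE /= /refl pairMnr.
  by rewrite spaceB // spaceMz // rmorphM /= -mulrzr; ring.
have G p : space p ->
    p (agrad a0 j) = (- (ashift j : nat)%:Z)%:~R <-> p (aroot a0 j) = (ashift j)%:R.
  move=> sp; rewrite /agrad; case: ashift => /=; rewrite ?spaceN //.
  by split=> [/oppr_inj|->].
apply/seteqP; split=> p [sp pE]; split=> //.
  apply/G => //; have := congr1 (fun q : P => q (aroot a0 j)) pE.
  rewrite /= E // (pair_coroot (aroot_root a0 j)) => /eqP.
  rewrite -subr_eq0 addrAC subrr add0r mulf_eq0 intr_eq0 /= subr_eq0.
  by move/eqP.
by apply/funext => c; rewrite E // (G p sp).1 // subrr mulr0 addr0.
Qed.

Lemma wallE x j (b := wX (alin x) (agrad a0 j)) :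
  wall a0 x j = hyperplane b (pair b (atrans x) - (ashift j : nat)%:Z) :> set P.
Proof.
have E p : aff_act x p b = (pair b (atrans x))%:~R + p (agrad a0 j).
  by rewrite /aff_act /b wXK.
rewrite /wall base_wallE; apply/seteqP; split=> [_ [p [sp pE] <-]|q [sq qE]].
  by split; [exact: aff_act_space|rewrite E pE rmorphD].
have qK : aff_act x (aff_act x^-1%g q) = q by rewrite aff_actM mulgV aff_act1.
exists (aff_act x^-1%g q) => //; split; first exact: aff_act_space.
by apply: (addrI (pair b (atrans x))%:~R); rewrite -E qK qE rmorphD.
Qed.

Hypothesis D_reduced : reduced D.

(** The sides of a wall are defined through some equation of it, so this equation has to be unique.
    Moving a point within the hyperplane shows that [b] vanishes wherever [a] does; the roots are
    then proportional, and reducedness applies. *)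
Lemma hyperplane_inj a b m n : positive a -> positive b ->
  hyperplane a m = hyperplane b n :> set P -> a = b /\ m = n.
Proof.
move=> /[dup] ap /andP[aR _] /[dup] bp /andP[bR _] E.
(* The point [(m / 2) a^vee], where [a] has the value [m]. *)
pose h : P := fun c => (pair c (coroot a))%:~R * (m%:~R / 2).
have sh : space h := space_pair (coroot a) (m%:~R / 2).
have ha : hyperplane a m h by split=> //; rewrite /h (pair_coroot aR); field.
have hb : h b = n%:~R by move: ha; rewrite E => -[].
have dir y : pair a y = 0 -> pair b y = 0.
  move=> ay; have : hyperplane a m ((fun c => h c + (pair c y)%:~R) : P).
    split; first by move=> c c'; rewrite sh pairDl rmorphD /=; ring.
    by rewrite ay addr0; case: ha.
  rewrite E => -[_]; rewrite hb -[RHS]addr0 => /addrI/eqP.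
  by rewrite intr_eq0 => /eqP.
have abE : a *~ pair b (coroot a) = b *~ 2.
  apply: pair_injl => y; rewrite !pairMzl.
  have := dir (y *~ 2 - coroot a *~ pair a y).
  by rewrite !pairrE (pair_coroot aR) => H; apply/eqP; rewrite -subr_eq0;
    apply/eqP; rewrite -oppr0 -[in RHS]H; ring.
have ba : b = a \/ b = - a.
  apply: (D_reduced aR bR _ abE); apply/eqP => b0; have := root_neq0 bR.
  case/eqP; apply: pair_injl => y; have := congr1 (fun c => pair c y) abE.
  by rewrite /= b0 !pairMzl mulr0 => /esym/eqP; rewrite mulf_eq0 orbF => /eqP.
have {ba}ba : b = a.
  case: ba => // bN; move: bp.
  by rewrite bN -[positive _]/(negative a) root_sign ?ap.
by split=> //; apply/eqP; rewrite -(eqr_int K) -hb ba; case: ha => _ ->.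
Qed.

Lemma fund_aff_act x j p (b := wX (alin x) (agrad a0 j)) : fund_alcove p ->
  (pair b (atrans x) - (ashift j : nat)%:Z)%:~R < aff_act x p b.
Proof.
move=> /[dup] fp [sp p0 p1]; rewrite /aff_act /b wXK rmorphD /= ltrD2l.
rewrite /agrad /aroot /ashift; case: unlift => [i|] //=.
by rewrite spaceN // ltrN2.
Qed.

(** The affine simple root is positive on the base alcove, hence its image under [x] is positive on
    the alcove of [x]: the side is the sign of the transported gradient. *)
Lemma on_positive_sideP x j :
  on_positive_side a0 K x j <-> positive (wX (alin x) (agrad a0 j)).
Proof.
set b := wX _ _; have bR : b \in R by apply/wX_root/agrad_root.
rewrite /on_positive_side base_alcoveE wallE -/b; split=> [|bp]; last first.
  exists b, (pair b (atrans x) - (ashift j : nat)%:Z); split=> // _ [p fp <-].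
  exact: fund_aff_act.
move=> [a [n [ap E sub]]]; rewrite -[positive b]negbK -root_sign //.
apply/negP => bn.
have E' : hyperplane (- b) (- (pair b (atrans x) - (ashift j : nat)%:Z)) =
    hyperplane a n :> set P.
  rewrite -E; apply/seteqP; split=> p [sp pE]; split=> //.
    by apply: oppr_inj; rewrite -spaceN // pE rmorphN.
  by rewrite spaceN // pE rmorphN.
have [bE nE] := hyperplane_inj bn ap E'.
have := fund_aff_act x j fund_pointP; rewrite -/b.
have := sub (aff_act x fund_point) (imageP _ fund_pointP) => /=.
rewrite -bE -nE spaceN; last exact/aff_act_space/(space_pair _ _).
by rewrite rmorphN ltrN2; lra.
Qed.

Lemma on_negative_sideP x j :
  on_negative_side a0 K x j <-> negative (wX (alin x) (agrad a0 j)).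
Proof.
set b := wX _ _; have bR : b \in R by apply/wX_root/agrad_root.
rewrite /on_negative_side base_alcoveE wallE -/b; split=> [|bn]; last first.
  exists (- b), (- (pair b (atrans x) - (ashift j : nat)%:Z)); split=> //.
    apply/seteqP; split=> p [sp pE]; split=> //.
      by rewrite spaceN // pE rmorphN.
    by apply: oppr_inj; rewrite -spaceN // pE rmorphN.
  move=> _ [p fp <-] /=; rewrite spaceN; last by apply: aff_act_space; case: fp.
  by rewrite rmorphN ltrN2; exact: fund_aff_act.
move=> [a [n [ap E sub]]]; rewrite root_sign //; apply/negP => bp.
have [bE nE] := hyperplane_inj bp ap E.
have := fund_aff_act x j fund_pointP; rewrite -/b.
have := sub (aff_act x fund_point) (imageP _ fund_pointP) => /=.
by rewrite -bE -nE; lra.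
Qed.

End Alcoves.

(** * Alcove walks in the Hecke algebra *)

Lemma pz_invP (A : pzRingType) (x : A) : (exists y, x * y = 1 /\ y * x = 1) ->
  x * pz_inv x = 1 /\ pz_inv x * x = 1.
Proof. by move=> [y xy]; rewrite /pz_inv; case: xgetP => [z _ //|/(_ y)]. Qed.

Lemma pz_inv_eq (A : pzRingType) (x y : A) : x * y = 1 -> y * x = 1 -> pz_inv x = y.
Proof.
move=> xy yx; have [|xV _] := @pz_invP A x; first by exists y.
by rewrite -[LHS]mul1r -yx -mulrA xV mulr1.
Qed.

(** * Sums over integer intervals of either orientation *)

Section IntegerSum.
Variable V : zmodType.
Implicit Type f : int -> V.

(* The sum of [f m] over [0 < m <= n], with the convention of integrals that
   it is minus the sum over [n < m <= 0] when [n < 0]. *)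
Definition isum (n : int) f : V :=
  match n with
  | Posz p => \sum_(0 <= r < p) f r.+1%:Z
  | Negz p => - \sum_(0 <= r < p.+1) f (- r%:Z)
  end.

Lemma isum0 f : isum 0 f = 0.
Proof. exact: big_geq. Qed.

Lemma isumS n f : isum (n + 1) f = isum n f + f (n + 1).
Proof.
case: n => n; first by rewrite -PoszD addn1 /isum big_nat_recr.
have -> : Negz n + 1 = - n%:Z by rewrite NegzE; lia.
rewrite [isum (Negz n) f]/isum big_nat_recr //= opprD addrNK.
by case: n => [|n]; [rewrite isum0 big_geq ?oppr0|rewrite -NegzE].
Qed.

Lemma eq_isum n f g : f =1 g -> isum n f = isum n g.
Proof. by move=> fg; congr isum; apply/funext. Qed.

Lemma int_rect_step (P : int -> Prop) : P 0 ->
  (forall n, P n <-> P (n + 1)) -> forall n, P n.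
Proof.
move=> P0 PS; case; elim=> [|n IH]; first exact: P0.
- by rewrite -addn1 PoszD; exact: (PS n).1.
- by apply: (PS _).2; rewrite NegzE addNr.
- by apply: (PS _).2; rewrite (_ : _ + 1 = Negz n) // !NegzE; lia.
Qed.

(** A function on the integers is determined by its value at 0 and its increments; this treats both
    signs of [n] at once. *)
Lemma isum_eq (f g : int -> V) : g 0 = 0 ->
  (forall n, g (n + 1) = g n + f (n + 1)) -> forall n, isum n f = g n.
Proof.
move=> g0 gS; apply: int_rect_step => [|n]; first by rewrite isum0.
by rewrite isumS gS; split=> [->|/addIr].
Qed.

Lemma isum_double (f : int -> V) n :
  isum (n * 2) f = isum n (fun m => f (m * 2 - 1) + f (m * 2)).
Proof.
symmetry; move: n; apply: (isum_eq (g := fun n => isum (n * 2) f)) => [|n].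
  exact: isum0.
have -> : (n + 1) * 2 = n * 2 + 1 + 1 by ring.
by rewrite !isumS addrK addrA.
Qed.

End IntegerSum.

Lemma isum_mulr (A : pzRingType) (n : int) (f : int -> A) (x : A) :
  isum n f * x = isum n (fun m => f m * x).
Proof.
symmetry; move: n; apply: isum_eq => [|n]; first by rewrite isum0 mul0r.
by rewrite isumS mulrDl.
Qed.

(** * Normalized Hecke generators *)

Section HeckeWalks.
Local Open Scope classical_set_scope.

Variables (K : realType) (D : based_root_datum) (D_reduced : reduced D).
Variables (a0 : highest_root D) (L : aff_weyl D -> nat).
Hypothesis L_param : parameter_system L.
Variables (k : comPzRingType) (v vV : k) (v_inv : v * vV = 1).
Local Notation X := (chars D).
Local Notation Y := (cochars D).
Local Notation R := (Defs.roots D).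
Local Notation H := (hecke a0 v L).
Implicit Types (a b c : X) (y z : Y) (w u : weyl D) (x : aff_weyl D).

Definition normT x : H := vV ^+ L x *: hecke_T a0 v L x.

Lemma scaleM2 (c d : k) (f g : H) : (c *: f) * (d *: g) = (c * d) *: (f * g).
Proof. by rewrite -qscaleAl -qscaleAr scalerA. Qed.

Lemma alg_mull (c : k) (h : H) : c *: (1 : H) * h = c *: h.
Proof. by rewrite -qscaleAl mul1r. Qed.

Lemma alg_mulr (c : k) (h : H) : h * (c *: (1 : H)) = c *: h.
Proof. by rewrite -qscaleAr mulr1. Qed.

Lemma normTM x x' : aff_length (x * x')%g = (aff_length x + aff_length x')%N ->
  normT x * normT x' = normT (x * x')%g.
Proof.
by move=> xx'; rewrite /normT scaleM2 hecke_TM // L_param // exprD.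
Qed.

Lemma vexpK n : v ^+ n * vV ^+ n = 1.
Proof. by rewrite -exprMn v_inv expr1n. Qed.

Lemma normT_inv x : exists h : H, normT x * h = 1 /\ h * normT x = 1.
Proof.
have [h [Th hT]] := hecke_T_inv a0 v L x; exists (v ^+ L x *: h).
by rewrite !scaleM2 Th hT mulrC vexpK scale1r.
Qed.

Lemma normT_inj x : injective (fun h : H => normT x * h).
Proof.
have [t [_ tT]] := normT_inv x; move=> h h' /= /(congr1 (fun g => t * g)).
by rewrite !mulrA tT !mul1r.
Qed.

Lemma length1 : aff_length (1%g : aff_weyl D) = 0%N.
Proof. by apply/length_eq0 => a _; rewrite sep1. Qed.

Lemma param1 : L 1%g = 0%N.
Proof.
have := L_param (x := 1%g) (y := 1%g).
by rewrite mulg1 length1 => /(_ erefl); lia.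
Qed.

Lemma lengthM_omega x o : omega o ->
  aff_length (x * o)%g = (aff_length x + aff_length o)%N.
Proof.
move=> /length_eq0 o0; apply: lengthM => a aR.
by rewrite o0 ?mulr0 // wX_root.
Qed.

(** Lengths add in [o o^-1 = 1], so two natural numbers [L o] and [L o^-1] have sum 0. *)
Lemma param_omega o : omega o -> L o = 0%N.
Proof.
move=> oO; have /length_eq0 o0 := oO.
have oV : omega o^-1%g.
  by apply/length_eq0 => a aR; rewrite sepV o0 ?oppr0 // wX_root.
have := L_param (lengthM_omega o oV); rewrite mulgV param1; lia.
Qed.

Lemma normT_omega o : omega o -> normT o = hecke_T a0 v L o.
Proof. by move=> oO; rewrite /normT param_omega // expr0 scale1r. Qed.

Local Notation s_ := (aff_refl a0).

Definition hecke_q j : k := v ^+ L (s_ j) - vV ^+ L (s_ j).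

(** In this form the relation says that a generator and its inverse differ by the scalar
    [hecke_q j]. *)
Lemma normT_quadratic j :
  normT (s_ j) * normT (s_ j) = 1 + hecke_q j *: normT (s_ j).
Proof.
have := hecke_T_quadratic a0 v L j; rewrite /= /normT /hecke_q.
set T := hecke_T _ _ _ _; set n := L _; move=> quad.
have TT : T * T = ((v ^+ 2) ^+ n - 1) *: T + (v ^+ 2) ^+ n *: (1 : H).
  apply/eqP; rewrite -subr_eq0 -quad mulrDl mul1r mulrBr -qscaleAr mulr1.
  by rewrite scalerBl scale1r !opprD opprK !addrA.
have ab : vV ^+ n * v ^+ n = 1 by rewrite mulrC vexpK.
rewrite scaleM2 TT scalerDr !scalerA mulrBr mulr1 expr2 exprMn mulrACA ab mulr1.
by rewrite scale1r addrC mulrBl vexpK.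
Qed.

(** * Walks after a large dominant translation *)

Definition shift (N : nat) : aff_weyl D := transl (rdom D *+ N).

Lemma sep_shift N x a :
  sep (shift N * x)%g a = pair a (rdom D) * N%:Z + sep x a.
Proof.
rewrite sepM /sep /= invg1 wX1 pairMnr; ring.
Qed.

Lemma sep_shift_le0 x a : negative a ->
  \forall N \near \oo, sep (shift N * x)%g a <= 0.
Proof.
rewrite negativeE => /andP[_ a_lt0].
near=> N; rewrite sep_shift.
have : (absz (sep x a) <= N)%N by near: N; exact: nbhs_infty_ge.
by nia.
Unshelve. all: by end_near. Qed.

(** Since [sep (s_ j)] is supported on the gradient and its negative, the criterion [lengthM]
    reduces to one sign. *)
Lemma lengthM_refl x j : sep x (wX (alin x) (agrad a0 j)) <= 0 ->
  aff_length (x * s_ j)%g = (aff_length x + aff_length (s_ j))%N.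
Proof.
have gR := agrad_root a0 j.
move=> le0; apply: lengthM => a aR; have := wXKV (alin x) a.
set b := wX _^-1%g a => bE; have bR : b \in R by exact: wX_root.
case: (sep (s_ j) b =P 0) => [->|/eqP/(sep_refl_neq0 D_reduced bR)[bj|bj]].
- by rewrite mulr0.
- by rewrite -bE bj sep_refl_agrad // mulrN1 oppr_ge0.
- by rewrite -bE bj wXN !sepN ?wX_root // sep_refl_agrad // opprK mulr1 oppr_ge0.
Qed.

Lemma wX_aff_refl x j :
  wX (alin (x * s_ j)%g) (agrad a0 j) = - wX (alin x) (agrad a0 j).
Proof. by rewrite -wXN -refl_agrad. Qed.

Lemma normT_up x j : negative (wX (alin x) (agrad a0 j)) ->
  \forall N \near \oo,
    normT (shift N * x)%g * normT (s_ j) = normT (shift N * (x * s_ j))%g.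
Proof.
move=> bn; near=> N; rewrite mulgA normTM // lengthM_refl //.
rewrite [alin _]/= mul1g; near: N; exact: sep_shift_le0.
Unshelve. all: by end_near. Qed.

(** A negative crossing is a positive one from [x s_j] traversed backwards, so its inverse generator
    undoes [normT_up]. *)
Lemma normT_crossing x j e :
  (if e then on_negative_side a0 K x j else on_positive_side a0 K x j) ->
  \forall N \near \oo, normT (shift N * x)%g *
    (if e then hecke_Tn a0 v L vV j else pz_inv (hecke_Tn a0 v L vV j)) =
    normT (shift N * (x * s_ j))%g.
Proof.
case: e => [/on_negative_sideP-/(_ D_reduced)/normT_up //|].
move=> /on_positive_sideP-/(_ D_reduced) bp.
have : negative (wX (alin (x * s_ j)%g) (agrad a0 j)).
  by rewrite wX_aff_refl negativeN.
move=> /normT_up; rewrite -mulgA aff_refl2 mulg1; apply: filterS => N <-.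
by rewrite -mulrA (pz_invP (normT_inv _)).1 mulr1.
Qed.

Lemma Phi_nonfolded (s : seq ('I_(nsimple D).+1 * bool)) o x :
  omega o -> nonfolded_from a0 K x s ->
  \forall N \near \oo, normT (shift N * x)%g * Phi a0 v L vV (s, o) =
    normT (shift N * (x * endpoint a0 (s, o)))%g.
Proof.
move=> oO; elim: s x => [|[j e] s IH] x /=.
  move=> _; near=> N; rewrite /Phi /endpoint /= !big_nil mul1r mul1g.
  by rewrite -normT_omega // normTM ?mulgA // lengthM_omega.
move=> [/normT_crossing cr /IH {}IH]; near=> N.
rewrite /Phi big_cons -mulrA -/(Phi a0 v L vV (s, o)) mulrA /=.
rewrite (near cr N) // (near IH N) //; congr normT.
by rewrite /endpoint big_cons /= !mulgA.
Unshelve. all: by end_near. Qed.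

Lemma exists_nonfolded x (s : seq 'I_(nsimple D).+1) :
  exists es, nonfolded_from a0 K x es /\ map fst es = s.
Proof.
elim: s x => [|j s IH] x; first by exists [::].
have [es [nf <-]] := IH (x * s_ j)%g.
case: (boolP (negative (wX (alin x) (agrad a0 j)))) => [bn|bp].
  by exists ((j, true) :: es); split=> //; split=> //; apply/on_negative_sideP.
exists ((j, false) :: es); split=> //; split=> //; apply/on_positive_sideP=> //.
by rewrite -[positive _]negbK -root_sign ?wX_root ?agrad_root.
Qed.

Lemma walk_toP x :
  nonfolded a0 K (walk_to a0 K x) /\ endpoint a0 (walk_to a0 K x) = x.
Proof.
rewrite /walk_to; case: xgetP => [p _ //|no].
have [s [o [oO xE]]] := aff_weyl_generation a0 D_reduced x.
have [es [nf esE]] := exists_nonfolded 1%g s.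
by case: (no (es, o)); split=> //; rewrite /endpoint /= xE -esE big_map.
Qed.

(** * The Hecke element of an end point *)

Definition Psi x : H := Phi a0 v L vV (walk_to a0 K x).

Lemma PsiP x : \forall N \near \oo, normT (shift N) * Psi x = normT (shift N * x)%g.
Proof.
have [[nf oO] ex] := walk_toP x; move: nf oO ex; rewrite /Psi.
case: walk_to => s o /= nf oO ex.
by have := Phi_nonfolded oO nf; apply: filterS => N; rewrite ex mulg1 mul1g.
Qed.

(** Each [normT (shift N)] can be cancelled, so a single large [N] determines [Psi x], whichever
    walk was chosen. *)
Lemma Psi_eq x h :
  (\forall N \near \oo, normT (shift N) * h = normT (shift N * x)%g) -> Psi x = h.
Proof.
move=> hE; have [N [/= <- /normT_inj]] := filter_ex (filterI hE (PsiP x)); exact.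
Qed.

Lemma Psi1 : Psi 1%g = 1.
Proof. by apply: Psi_eq; near=> N; rewrite mulr1 mulg1.
Unshelve. all: by end_near. Qed.

Lemma Psi_up x j : negative (wX (alin x) (agrad a0 j)) ->
  Psi (x * s_ j)%g = Psi x * normT (s_ j).
Proof.
move=> bn; apply: Psi_eq; have up := normT_up bn; have := PsiP x => Px.
by near=> N; rewrite mulrA (near Px N) // (near up N).
Unshelve. all: by end_near. Qed.

Lemma Psi_down x j : positive (wX (alin x) (agrad a0 j)) ->
  Psi x = Psi (x * s_ j)%g * normT (s_ j).
Proof.
move=> bp; rewrite -Psi_up; first by rewrite -mulgA aff_refl2 mulg1.
by rewrite wX_aff_refl negativeN.
Qed.

Lemma Psi_omega x o : omega o -> Psi (x * o)%g = Psi x * normT o.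
Proof.
move=> oO; apply: Psi_eq; have := PsiP x => Px; near=> N.
by rewrite mulrA (near Px N) // normTM ?mulgA // lengthM_omega.
Unshelve. all: by end_near. Qed.

(** Induction along walks. Positive crossings suffice because the hypothesis on them is an
    equivalence, usable backwards for negative ones. *)
Lemma aff_weyl_rect (Q : aff_weyl D -> Prop) : Q 1%g ->
  (forall x j, negative (wX (alin x) (agrad a0 j)) -> Q x <-> Q (x * s_ j)%g) ->
  (forall x o, omega o -> Q x -> Q (x * o)%g) -> forall x, Q x.
Proof.
move=> Q1 Qs Qo x; have [s [o [oO ->]]] := aff_weyl_generation a0 D_reduced x.
apply: Qo => //; elim/last_ind: s => [|s j IH]; first by rewrite big_nil.
rewrite -cats1 big_cat big_seq1; move: (\prod_(j <- s) _)%g IH => x' IH.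
have bR : wX (alin x') (agrad a0 j) \in R by rewrite wX_root // agrad_root.
case: (boolP (negative (wX (alin x') (agrad a0 j)))) => [/Qs/iffLR|]; first exact.
rewrite root_sign // negbK => bp.
have /Qs : negative (wX (alin (x' * s_ j)%g) (agrad a0 j)).
  by rewrite wX_aff_refl negativeN.
by rewrite -mulgA aff_refl2 mulg1 => /iffRL; apply.
Qed.

(** A translation fixes all gradients, so the translated walk has the same signs. *)
Lemma Psi_transl y x : Psi (transl y * x)%g = Psi (transl y) * Psi x.
Proof.
move: x; apply: aff_weyl_rect => [|x j bn|x o oO IH].
- by rewrite mulg1 Psi1 mulr1.
- have [t [Tt tT]] := normT_inv (s_ j).
  rewrite mulgA !Psi_up //.
  rewrite mulrA; split=> [->//|/(congr1 (fun h => h * t))].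
  by rewrite -!mulrA Tt !mulr1.
- by rewrite mulgA !(Psi_omega _ oO) IH mulrA.
Qed.

Lemma length_refl j : aff_length (s_ j) = 1%N.
Proof.
have gR := agrad_root a0 j.
have gN : - agrad a0 j != agrad a0 j.
  apply/eqP => /(congr1 (fun b => pair b (rdom D))); rewrite pairNl.
  by have := rdom_root gR; lia.
apply: double_inj; rewrite length_sep (bigD1_seq (agrad a0 j)) ?roots_uniq //=.
rewrite big_mkcond (bigD1_seq (- agrad a0 j)) ?roots_uniq ?rootN //= gN.
rewrite sepN // !sep_refl_agrad // big1_seq // => a /andP[aN aR].
case: ifP => // ag; apply/eqP; rewrite absz_eq0; apply: contraT.
by case/(sep_refl_neq0 D_reduced aR) => aE; rewrite aE eqxx in ag aN.
Qed.

(** When lengths add, both sides have parameter [L x] plus that of the reflection. *)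
Lemma param_conj x i j : (x * s_ j = s_ i * x)%g -> L (s_ j) = L (s_ i).
Proof.
(* Otherwise [x s_j] satisfies the same relation and lies on the other side of the wall. *)
wlog le0 : x / sep x (wX (alin x) (agrad a0 j)) <= 0 => [hw|] E.
  case: (leP (sep x (wX (alin x) (agrad a0 j))) 0) => [le0|gt0]; first exact: hw E.
  apply: (hw (x * s_ j)%g); last first.
    by rewrite -[in LHS]mulgA aff_refl2 mulg1 E mulgA aff_refl2 mul1g.
  rewrite wX_aff_refl sepN ?wX_root ?agrad_root // sepM wXK sep_refl_agrad //.
  by lia.
have len := lengthM_refl le0; have := L_param len; rewrite E L_param; first by lia.
by rewrite -E len !length_refl addnC.
Qed.

Lemma agrad_positive j : positive (agrad a0 j) = ~~ ashift j.
Proof.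
rewrite /agrad /aroot /ashift; case: unlift => [i|] /=.
  exact: simple_positive.
rewrite -[positive _]/(negative a0) root_sign ?hroot_root //.
by rewrite hroot_positive.
Qed.

(** * Reflecting a walk by [s_i] *)

Section BernsteinRelation.
Variable i : 'I_(nsimple D).
Local Notation al := (simple i).
Local Notation alc := (coroot (simple i : X)).
Local Notation si := (s_ (lift ord0 i)).

Lemma aff_refl_lift : si = lin (simple_refl i).
Proof. by rewrite /aff_refl liftK. Qed.

(* If [x] and [x s_j] are separated by the hyperplane [H_(al, m)], then
   [x s_j] is the image of [x] under the reflection in this hyperplane. *)
Lemma crossing x j (m := pair al (atrans x) + (ashift j : nat)%:Z) :
  wX (alin x) (agrad a0 j) = - al ->
  [/\ (si * x = transl (- (alc *~ m)) * (x * s_ j))%g,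
      sep (x * s_ j)%g al = m & sep x al = m - 1].
Proof.
move=> bE.
have alE : wX (alin x)^-1%g al = - agrad a0 j.
  by rewrite -[al]opprK -bE wXN wXK.
have sepx : sep x al = m - 1.
  rewrite /sep alE negativeN agrad_positive [negative al]root_sign ?simple_root //.
  by rewrite simple_positive /m; case: ashift => /=; lia.
split=> //; last first.
  by rewrite sepM sepx alE sepN ?agrad_root // sep_refl_agrad // opprK subrK.
have wE : wX (alin x) (aroot a0 j) = al \/ wX (alin x) (aroot a0 j) = - al.
  move: bE; rewrite /agrad; case: ashift; rewrite ?wXN; last by right.
  by move/oppr_inj; left.
rewrite aff_refl_lift aff_reflE.
rewrite -[LHS]/(aff_mul _ _) -[RHS]/(aff_mul _ (aff_mul _ _)).
rewrite /aff_mul /= mul1g add0r; congr AffWeyl; last first.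
  rewrite weyl_refl_conj; congr (_ * _)%g; symmetry; exact: weyl_reflE.
have -> : wY (alin x) (coroot (aroot a0 j) *+ ashift j) = alc *+ ashift j.
  move: bE; rewrite /agrad; case: ashift; rewrite ?mulr0n ?wY0 // !mulr1n wXN.
  by move/oppr_inj <-; rewrite coroot_weyl ?aroot_root.
rewrite /corefl; apply: pair_injr => c; rewrite !pairrE /m; ring.
Qed.

(** [Q m] is the constant of the wall type at [H_(al, m)]; it is chosen according to whether [al] is
    in [2 X]. *)
Variable Q : int -> k.
Hypothesis QE : forall x j, wX (alin x) (agrad a0 j) = - al ->
  Q (pair al (atrans x) + (ashift j : nat)%:Z) = hecke_q j.

Local Notation U := (pz_inv (normT si)).
Local Notation G x :=
  (isum (sep x al) (fun m => Q m *: Psi (transl (- (alc *~ m)) * x)%g)).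

(** The base alcove is on the positive side of its wall of type [i], so leaving through it has the
    sign [-]. *)
Lemma Psi_simple : Psi si = U.
Proof.
have := @Psi_down 1%g (lift ord0 i); rewrite wX1 agrad_lift mul1g Psi1.
move=> /(_ (simple_positive i)) PT; rewrite -[LHS]mulr1.
by rewrite -(pz_invP (normT_inv si)).1 mulrA -PT mul1r.
Qed.

(* The walk from the base alcove to [x], reflected by [s_i] and preceded by the
   step across the wall of type [i], crosses the hyperplanes of direction [al]
   in the wrong direction; each correction contributes one folded walk, which
   is a translate of the remaining walk. *)
Lemma simple_mul_Psi x : U * Psi x = Psi (si * x)%g + G x.
Proof.
move: x; apply: aff_weyl_rect => [|x j bn|x o oO IH].
- by rewrite Psi1 sep1 isum0 mulr1 mulg1 addr0 Psi_simple.
- have [t [Tt tT]] := normT_inv (s_ j).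
  suff E : Psi (si * (x * s_ j))%g + G (x * s_ j)%g =
      (Psi (si * x)%g + G x) * normT (s_ j).
    rewrite Psi_up // E [U * (_ * normT _)]mulrA.
    split=> [->//|/(congr1 (fun h => h * t))].
    by rewrite -!mulrA Tt !mulr1.
  have fE n : isum n (fun m => Q m *: Psi (transl (- (alc *~ m)) * (x * s_ j))%g) =
      isum n (fun m => Q m *: Psi (transl (- (alc *~ m)) * x)%g) * normT (s_ j).
    rewrite isum_mulr; apply: eq_isum => m.
    by rewrite mulgA Psi_up // qscaleAl.
  have alin_si :
      wX (alin (si * x)%g) (agrad a0 j) = refl al (wX (alin x) (agrad a0 j)).
    by rewrite aff_refl_lift.
  have bR : wX (alin x) (agrad a0 j) \in R by rewrite wX_root ?agrad_root.
  (* A crossing of direction [al] changes sign under [s_i]; the quadratic relation repairs it at the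
     cost of the summand at [m]. *)
  case: (wX (alin x) (agrad a0 j) =P - al) => [bE|/eqP bN].
    have [xE sxE sx] := crossing bE; have := QE bE.
    set m := _ + _ in xE sxE sx * => Qm.
    have bp : positive (wX (alin (si * x)%g) (agrad a0 j)).
      rewrite alin_si bE -[refl _ _]/(wX (simple_refl i) _) wXN /=.
      have -> : refl al al = - al.
        apply: pair_injl => y.
        by rewrite /refl !pairlE (pair_coroot (simple_root i)); ring.
      by rewrite opprK simple_positive.
    rewrite sxE -[in LHS](subrK 1 m) isumS fE -sx mulrDl sx subrK Qm -xE.
    rewrite (Psi_down bp) -mulrA normT_quadratic mulrDr mulr1.
    rewrite -[_ * (_ *: normT _)]qscaleAr mulgA.
    by rewrite [RHS]addrAC addrA.
  (* All other crossings keep their sign, as [s_i] permutes the positive roots other than [al]. *)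
  have sbn : negative (wX (alin (si * x)%g) (agrad a0 j)).
    rewrite alin_si -[refl _ _]/(wX (simple_refl i) _) /negative -wXN.
    by apply: refl_simple_positive; rewrite // eqr_oppLR.
  have -> : sep (x * s_ j)%g al = sep x al.
    rewrite sepM; case: (sep (s_ j) (wX (alin x)^-1%g al) =P 0) => [->|/eqP].
      by rewrite addr0.
    case/(sep_refl_neq0 D_reduced (wX_root _ (simple_root i))) => gE.
      by move: bn; rewrite -gE wXKV root_sign ?simple_root // simple_positive.
    by move: bN; rewrite -[agrad a0 j]opprK -gE wXN wXKV eqxx.
  by rewrite fE mulrDl mulgA Psi_up.
- rewrite mulgA !(Psi_omega _ oO) mulrA IH mulrDl; congr (_ + _).
  have -> : sep (x * o)%g al = sep x al.
    have /length_eq0 o0 := oO.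
    by rewrite sepM o0 ?addr0 // wX_root // simple_root.
  rewrite isum_mulr; apply: eq_isum => m.
  by rewrite mulgA (Psi_omega _ oO) -[LHS]qscaleAl.
Qed.

Lemma tW_simple : tW a0 v L vV K (simple_refl i) = normT si.
Proof.
rewrite /tW weyl_reflV -aff_refl_lift -/(Psi si) Psi_simple.
have [TU UT] := pz_invP (normT_inv si); exact: pz_inv_eq.
Qed.

Lemma normT_inv_simple : U = normT si - hecke_q (lift ord0 i) *: (1 : H).
Proof.
have quad := normT_quadratic (lift ord0 i).
by apply: pz_inv_eq; rewrite (mulrBl, mulrBr) (alg_mull, alg_mulr) quad addrK.
Qed.

(** This is [simple_mul_Psi] at a translation, with [s_i epsilon^lam = epsilon^(s_i lam) s_i] and
    both inverses replaced by [normT_inv_simple]. *)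
Lemma simple_mul_theta lam (th := theta a0 v L vV K) (n := pair al lam) :
  normT si * th lam = th (wY (simple_refl i) lam) * normT si +
    hecke_q (lift ord0 i) *: (th lam - th (lam - alc *~ n)) +
    isum n (fun m => Q m *: th (lam - alc *~ m)).
Proof.
have thE y : th y = Psi (transl y) by [].
have := simple_mul_Psi (transl lam).
have -> : sep (transl lam) al = n by rewrite /sep /= invg1 wX1 subrK.
have -> : (si * transl lam = transl (wY (simple_refl i) lam) * si)%g.
  rewrite aff_refl_lift -[LHS]/(aff_mul _ _) -[RHS]/(aff_mul _ _) /aff_mul /=.
  by rewrite add0r addr0 mulg1 mul1g.
rewrite Psi_transl // Psi_simple normT_inv_simple -!thE.
rewrite mulrBl mulrBr alg_mull alg_mulr => /eqP.
rewrite subr_eq => /eqP->; rewrite -[wY _ _]/(lam - alc *~ n) scalerBr.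
set S := isum _ _; set S' := isum _ _.
have -> : S = S'.
  apply: eq_isum => m; rewrite thE; congr (_ *: Psi _).
  rewrite -[LHS]/(aff_mul _ _) /aff_mul /= mulg1; congr AffWeyl.
  by rewrite addrC.
rewrite addrAC; congr (_ + _); rewrite -addrA; congr (_ + _); exact: addrC.
Qed.

End BernsteinRelation.

(** * The fractions as functions of the number of terms, and products of [theta] *)

Lemma theta_frac_step y z n (frac := theta_frac a0 v L vV K) :
  frac y z (n + 1) = frac y z n + theta a0 v L vV K (y - z *~ n).
Proof.
rewrite /frac /theta_frac; case: n => n.
  by rewrite -PoszD addn1 /= big_nat_recr //= -pmulrn.
have fracN (m : nat) : frac y z (- m%:Z) =
    - \sum_(1 <= r < m.+1) theta a0 v L vV K (y + z *+ r).
  by case: m => [|m]; rewrite /frac /theta_frac //= !big_geq ?oppr0.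
rewrite -!/(theta_frac _ _ _ _ _ _ _ _) -/frac.
have -> : Negz n + 1 = - n%:Z by rewrite NegzE; lia.
rewrite NegzE !fracN mulrNz opprK -pmulrn.
rewrite [X in _ = - X + _](@big_nat_recr _ _ _ n.+1) //=.
by rewrite opprD addrNK.
Qed.

Lemma theta_frac0 y z : theta_frac a0 v L vV K y z 0 = 0.
Proof. by rewrite /theta_frac lexx big_geq. Qed.

Lemma thetaD y z :
  theta a0 v L vV K (y + z) = theta a0 v L vV K y * theta a0 v L vV K z.
Proof.
rewrite -[RHS]/(Psi (transl y) * Psi (transl z)) -Psi_transl //.
by rewrite -[(transl y * _)%g]/(aff_mul _ _) /aff_mul /= mulg1.
Qed.

End HeckeWalks.

(* A root [a] outside [2 X] takes an odd value [2 h + 1] at some [m]; then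
   [m - h a^vee] has pairing [1] with [a]. *)
Lemma pair_surjective (D : based_root_datum) (a : chars D) (n : int) :
  a \in Defs.roots D -> ~ in_double a -> exists y, pair a y = n.
Proof.
move=> aR ndbl; have [y yo] : exists y, (pair a y %% 2)%Z <> 0.
  apply: contrapT => /forallNP ev; apply: ndbl.
  have evE y : pair a y = (pair a y %/ 2)%Z * 2.
    by rewrite {1}(divz_eq (pair a y) 2) (contrapT (ev y)) addr0.
  have [|x [xE _]] := @pair_of_additive D (fun y => (pair a y %/ 2)%Z).
    move=> y z /=; have := evE y; have := evE z; have := evE (y - z).
    by rewrite pairBr; lia.
  by exists x; apply: pair_injl => y; rewrite pairMnl xE -evE.
exists ((y - coroot a *~ (pair a y %/ 2)%Z) *~ n).
rewrite !pairrE (pair_coroot aR).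
by rewrite (_ : pair a y - 2 * _ = 1) ?mul1r //; lia.
Qed.

(** * The Bernstein relation in its two cases *)

Theorem mainTheorem4
  (K : realType) (D : based_root_datum) (D_reduced : reduced D)
  (D_irreducible : irreducible D) (a0 : highest_root D)
  (L : aff_weyl D -> nat) (L_param : parameter_system L)
  (k : comPzRingType) (v vV : k) (v_inv : v * vV = 1)
  (i : 'I_(nsimple D)) (lam : cochars D) :
  let th := theta a0 v L vV K in
  let ts := tW a0 v L vV K (simple_refl i) in
  let slam := wY (simple_refl i) lam in
  let n := pair (simple i) lam in
  let ac := coroot (simple i) in
  let Li := L (aff_refl a0 (lift ord0 i)) in
  let L0 := L (aff_refl a0 ord0) in
  let frac := theta_frac a0 v L vV K in
  (~ in_double (simple i) ->
     ts * th lam = th slam * ts + (v ^+ Li - vV ^+ Li) *: frac lam ac n) /\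
  (in_double (simple i) ->
     ts * th lam = th slam * ts +
       ((v ^+ Li - vV ^+ Li) *: (1 : hecke a0 v L) +
        (v ^+ L0 - vV ^+ L0) *: th (- ac)) *
       frac lam (ac *+ 2) (n %/ 2)%Z).
Proof.
move=> th ts slam n ac Li L0 frac.
have tsE : ts = normT a0 L v vV (aff_refl a0 (lift ord0 i)).
  exact: (tW_simple K D_reduced a0 L_param v_inv).
have fracS y b m : frac y b (m + 1) = frac y b m + th (y - b *~ m).
  exact: theta_frac_step.
have frac0 y b : frac y b 0 = 0 by exact: theta_frac0.
have aR := simple_root i.
(* If the hyperplane [H_(al, m)] with [m = <al, mu>] is the wall of type [j] of
   [x a], then [s_j] is conjugate to [s_i] by [epsilon^(-mu) x]. *)
have wallL x j (mu : cochars D) : wX (alin x) (agrad a0 j) = - simple i ->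
    pair (simple i) (atrans x) + (ashift j : nat)%:Z = pair (simple i) mu ->
    L (aff_refl a0 j) = Li.
  move=> bE mE; have [xE _ _] := crossing D_reduced bE.
  apply: (param_conj D_reduced L_param (x := (transl (- mu) * x)%g)).
  have xE' : (x * aff_refl a0 j = transl (ac *~ pair (simple i) mu) *
      (aff_refl a0 (lift ord0 i) * x))%g.
    rewrite xE mE mulgA.
    rewrite -[(transl (ac *~ _) * transl _)%g]/(aff_mul _ _) /aff_mul /=.
    rewrite mulg1 addrN.
    exact/esym/mul1g.
  rewrite -mulgA xE' !mulgA; congr (_ * _)%g; rewrite aff_refl_lift.
  rewrite -![(_ * _)%g]/(aff_mul _ _) /aff_mul /= ?mul1g ?mulg1; congr AffWeyl.
  by rewrite addr0 add0r /corefl pairNr mulrNz opprK.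
rewrite tsE; split=> [ndbl|[a aE]].
  (* Every integer is a value of [simple i], so all parallel hyperplanes carry the constant of
     [s_i]. *)
  rewrite (simple_mul_theta K D_reduced L_param v_inv
    (Q := fun=> hecke_q a0 L v vV (lift ord0 i))); last first.
    move=> x j bE; have [mu muE] := pair_surjective
      (pair (simple i) (atrans x) + (ashift j : nat)%:Z) aR ndbl.
    by rewrite /hecke_q (wallL x j mu).
  rewrite -!addrA; congr (_ + _); apply/eqP; rewrite eq_sym addrC -subr_eq eq_sym.
  apply/eqP; rewrite -/th -/n -/ac /hecke_q -/Li.
  (* As functions of [n], both sides vanish at 0 and have equal increments. *)
  set q := _ - _; move: n; apply: isum_eq => [|m].
    by rewrite frac0 mulr0z subr0 subrr !scaler0 subrr.
  rewrite fracS !scalerBr scalerDr !opprB.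
  by rewrite !addrA [RHS](ACl (1*2*4*3)).
have nE : n = pair a lam * 2 by rewrite /n aE pairMnl.
(* The root takes only even values on cocharacters: even [m] are conjugate to type [i], and odd [m]
   arise only from the shift of type 0. *)
rewrite (simple_mul_theta K D_reduced L_param v_inv (Q := fun m => hecke_q a0 L v vV
  (if (m %% 2)%Z == 0 then lift ord0 i else ord0))); last first.
  move=> x j bE; rewrite aE pairMnl.
  have [jE|j0] := eqVneq j ord0; last first.
    have e0 : ashift j = false.
      by rewrite /ashift; case: unliftP j0 => // ->; rewrite eqxx.
    rewrite e0 addr0 modzMl eqxx /hecke_q (wallL x j (atrans x)) //.
    by rewrite e0 addr0.
  rewrite jE /ashift unlift_none /=.
  by rewrite (_ : ((_ * 2 + 1) %% 2)%Z = 1) //; lia.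
rewrite -!addrA; congr (_ + _); apply/eqP; rewrite eq_sym addrC -subr_eq eq_sym.
apply/eqP; rewrite -/th -/n -/ac nE mulzK // isum_double /hecke_q -/Li -/L0.
set q := v ^+ Li - _; set q0 := v ^+ L0 - _.
have AE z : (q *: (1 : hecke a0 v L) + q0 *: th (- ac)) * th z =
    q *: th z + q0 *: th (- ac + z).
  rewrite mulrDl alg_mull; congr (_ + _); rewrite -qscaleAl; congr (_ *: _).
  exact/esym/thetaD.
(* The variable is now half of [n]; each increment joins an odd hyperplane with the following even
   one. *)
move: (pair a lam); apply: isum_eq => [|m].
  by rewrite frac0 mulr0 mul0r mulr0z subr0 subrr scaler0 subrr.
have -> : ((m + 1) * 2 %% 2)%Z = 0 by lia.
have -> : (((m + 1) * 2 - 1) %% 2)%Z = 1 by lia.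
rewrite /= -/q -/q0 fracS mulrDr AE.
have -> : lam - ac *+ 2 *~ m = lam - ac *~ (m * 2).
  by apply: pair_injr => c; rewrite !pairrE; ring.
have -> : - ac + (lam - ac *~ (m * 2)) = lam - ac *~ ((m + 1) * 2 - 1).
  by apply: pair_injr => c; rewrite !pairrE; ring.
rewrite !scalerBr !opprB.
by rewrite !addrA [RHS](ACl (1*2*4*5*3)).
Qed.
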